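(* Suppose that the level set $\mathcal{X}:=\{x\in\mathrm{dom}(F):F(x)\leq F(x^0)\}$ is compact. If the function $Q$ is a proper closed KL function, then the sequence $\{x^k:k\in\mathbb{N}\}$ generated by the algorithm AMPDA converges to a critical point of $F$ (i.e., of the problem $\min\{f(x)/g(x)+h(x):x\in\Omega\cap\mathcal{C}\}$).
   Context: Setting: $f,g:\mathbb{R}^n\to[0,+\infty)$ and $h:\mathbb{R}^n\to\mathbb{R}$ are proper closed (lower semicontinuous), $\mathcal{C}\subseteq\mathbb{R}^n$ is closed, $\Omega:=\{x\in\mathbb{R}^n: g(x)\neq 0\}$, and $\mathcal{C}\cap\Omega\neq\emptyset$. Standing assumptions: (i) $f$ is locally Lipschitz continuous on $\Omega$; (ii) $g$ is convex on $\mathbb{R}^n$; (iii) $h=h_1-h_2$, where $h_1:\mathbb{R}^n\to\mathbb{R}$ is locally Lipschitz differentiable around each $x\in\Omega$ (each $x\in\Omega$ has a ball on which $h_1$ is continuously differentiable with Lipschitz gradient) and $h_2:\mathbb{R}^n\to\mathbb{R}$ is convex; (iv) the proximal operator of $f_{\mathcal{C}}$ can be evaluated, where $f_{\mathcal{C}}:=f+\iota_{\mathcal{C}}$ and $\iota_{\mathcal{C}}$ is $0$ on $\mathcal{C}$, $+\infty$ elsewhere. Notation: $\mathbb{N}$ is the set of nonnegative integers. $F(x)=f(x)/g(x)+h(x)$ if $x\in\Omega\cap\mathcal{C}$, $F(x)=+\infty$ otherwise. $\mathrm{prox}_{\varphi}(x):=\arg\min\{\varphi(z)+\frac12\|x-z\|_2^2:z\in\mathbb{R}^n\}$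 (a set). $\partial g,\partial h_2$ are convex subdifferentials; $g^*,h_2^*$ are convex conjugates. The function $Q:\mathbb{R}^n\times\mathbb{R}^n\times\mathbb{R}^n\times\mathbb{R}\to(-\infty,+\infty]$ is $$Q(x,y,z,c)=\iota_{\mathcal{C}}(x)+2cf(x)+c^2f(x)(g^*(y)-\langle x,y\rangle)+h_1(x)+h_2^*(z)-\langle x,z\rangle$$ if $(y,z)\in\mathrm{dom}(g^* )\times\mathrm{dom}(h_2^* )$, and $+\infty$ otherwise. Subdifferentials: for proper $\varphi$ and $x\in\mathrm{dom}(\varphi)$, the Fréchet subdifferential is $\widehat{\partial}\varphi(x):=\{y:\liminf_{z\to x,z\neq x}\frac{\varphi(z)-\varphi(x)-\langle y,z-x\rangle}{\|z-x\|_2}\geq0\}$ and the limiting subdifferential $\partial\varphi(x)$ is the set of $y$ for which there are $x^k\to x$ with $\varphi(x^k)\to\varphi(x)$ and $y^k\in\widehat{\partial}\varphi(x^k)$ with $y^k\to y$; both are empty outside $\mathrm{dom}(\varphi)$; $\mathrm{dom}(\partial\varphi)=\{x:\partial\varphi(x)\neq\emptyset\}$. $\mathrm{dist}(x,\mathcal{A})=\inf\{\|x-y\|_2:y\in\mathcal{A}\}$, with $\mathrm{dist}(x,\emptyset)=+\infty$. KL function: a proper $\varphi$ satisfies the KL property at $x\in\mathrm{dom}(\partial\varphi)$ if there exist $\epsilon\in(0,+\infty]$, $\delta>0$ and a continuous concave $\phi:[0,\epsilon)\to[0,+\infty)$ with $\phi(0)=0$, $\phi$ continuously differentiable on $(0,\epsilon)$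 with $\phi'>0$, and $\phi'(\varphi(z)-\varphi(x))\,\mathrm{dist}(0,\partial\varphi(z))\geq1$ for every $z$ with $\|z-x\|_2<\delta$ and $\varphi(x)<\varphi(z)<\varphi(x)+\epsilon$. $\varphi$ is a KL function if it satisfies the KL property at every point of $\mathrm{dom}(\partial\varphi)$. ''Closed'' means lower semicontinuous. Algorithm AMPDA. Step 0: input $x^0\in\mathrm{dom}(F)$, $0<\underline{\alpha}\leq\overline{\alpha}$, $\sigma>0$, $0<\gamma<1$; set $k=0$. Step 1: compute $c_k=1/g(x^k)$; choose any $(y^k,z^k)\in\partial g(x^k)\times\partial h_2(x^k)$; set $\alpha:=\widetilde{\alpha}_k$ for some $\widetilde{\alpha}_k\in[\underline{\alpha},\overline{\alpha}]$. Step 2: compute any $$\widehat{x}^k\in\mathrm{prox}_{\alpha c_kf_{\mathcal{C}}}\big(x^k-\alpha(\nabla h_1(x^k)-z^k-c_k^2f(x^k)y^k)\big).$$ If $\widehat{x}^k\in\Omega$ and $Q(\widehat{x}^k,y^k,z^k,1/g(\widehat{x}^k))+\frac{\sigma}{2}\|\widehat{x}^k-x^k\|_2^2\leq F(x^k)$, then set $x^{k+1}=\widehat{x}^k$ and go to Step 3; else set $\alpha:=\alpha\gamma$ and repeat Step 2. Step 3: record $\alpha_k:=\alpha$, set $k\leftarrow k+1$, and go to Step 1. Critical point: $x^{\star}\in\Omega$ is a critical point of $F$ if, with $c_{\star}=1/g(x^{\star})$, $0\in\widehat{\partial}(c_{\star}f+\iota_{\mathcal{C}})(x^{\star})-c_{\star}^2f(x^{\star})\,\partial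 g(x^{\star})+\nabla h_1(x^{\star})-\partial h_2(x^{\star})$. *)

(* Defs.v *)
From mathcomp Require Import all_boot all_order all_algebra.
From mathcomp Require Import all_classical all_reals all_analysis.

Set Implicit Arguments.
Unset Strict Implicit.
Unset Printing Implicit Defensive.

Import Order.TTheory GRing.Theory Num.Theory.
Import numFieldNormedType.Exports.

Local Open Scope classical_set_scope.
Local Open Scope ring_scope.

(* The norm [`|x|] that the library puts on ['rV[R]_n] is the sup norm; every
   metric notion below is stated with the Euclidean norm instead.  Convergence,
   closedness, compactness, lower semicontinuity and differentiability are the
   library's: they only depend on the topology of R^n, which is the same for
   both norms. *)
Definition dot (R : realType) (n : nat) (x y : 'rV[R]_n) : R :=
  \sum_(i < n) x 0 i * y 0 i.

Definition norm2 (R : realType) (n : nat) (x : 'rV[R]_n) : R :=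
  Num.sqrt (dot x x).

Definition ball2 (R : realType) (n : nat) (x : 'rV[R]_n) (r : R) :
    set 'rV[R]_n :=
  [set z | norm2 (z - x) < r].

(* [+oo] when [A] is empty *)
Definition dist (R : realType) (n : nat) (x : 'rV[R]_n) (A : set 'rV[R]_n) :
    \bar R :=
  ereal_inf [set (norm2 (x - y))%:E | y in A].

Definition dom (R : realType) (T : Type) (phi : T -> \bar R) : set T :=
  [set x | (phi x < +oo)%E].

Definition proper_fun (R : realType) (T : Type) (phi : T -> \bar R) : Prop :=
  dom phi !=set0 /\ forall x, (-oo < phi x)%E.

Definition indic_ext (R : realType) (T : Type) (C : set T) (x : T) : \bar R :=
  if x \in C then 0%E else +oo%E.

Definition locally_lipschitz (R : realType) (n : nat) (A : set 'rV[R]_n)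
    (f : 'rV[R]_n -> R) : Prop :=
  forall x, A x -> exists r L : R, 0 < r /\
    forall u v, (ball2 x r `&` A) u -> (ball2 x r `&` A) v ->
      `|f u - f v| <= L * norm2 (u - v).

Definition grad (R : realType) (n : nat) (f : 'rV[R]_n -> R) (x : 'rV[R]_n) :
    'rV[R]_n :=
  \row_i 'D_(delta_mx 0 i) f x.

(* Continuity of the gradient on the ball is part of its being Lipschitz. *)
Definition locally_lipschitz_differentiable (R : realType) (n : nat)
    (A : set 'rV[R]_n) (f : 'rV[R]_n -> R) : Prop :=
  forall x, A x -> exists r L : R, [/\ 0 < r,
    forall u, ball2 x r u -> differentiable f u &
    forall u v, ball2 x r u -> ball2 x r v ->
      norm2 (grad f u - grad f v) <= L * norm2 (u - v)].

Definition conj_fun (R : realType) (n : nat) (f : 'rV[R]_n -> R)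
    (y : 'rV[R]_n) : \bar R :=
  ereal_sup [set (dot x y - f x)%:E | x in setT].

Definition cvx_subdiff (R : realType) (n : nat) (f : 'rV[R]_n -> R)
    (x : 'rV[R]_n) : set 'rV[R]_n :=
  [set y | forall z, f x + dot y (z - x) <= f z].

Definition prox (R : realType) (n : nat) (phi : 'rV[R]_n -> \bar R)
    (x : 'rV[R]_n) : set 'rV[R]_n :=
  [set z | forall w, (phi z + (2^-1 * norm2 (x - z) ^+ 2)%:E
                      <= phi w + (2^-1 * norm2 (x - w) ^+ 2)%:E)%E].

Definition frechet_subdiff (R : realType) (n : nat) (phi : 'rV[R]_n -> \bar R)
    (x : 'rV[R]_n) : set 'rV[R]_n :=
  [set y | dom phi x /\
    (0 <= limf_einf (fun z => (phi z - phi x - (dot y (z - x))%:E)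
                              * ((norm2 (z - x))^-1)%:E) x^')%E].

Definition lim_subdiff (R : realType) (n : nat) (phi : 'rV[R]_n -> \bar R)
    (x : 'rV[R]_n) : set 'rV[R]_n :=
  [set y | dom phi x /\ exists u v : nat -> 'rV[R]_n,
    [/\ u @ \oo --> x,
        (phi \o u) @ \oo --> phi x,
        forall k, frechet_subdiff phi (u k) (v k) &
        v @ \oo --> y]].

Definition desingularizing (R : realType) (eps : \bar R) (psi : R -> R) :
    Prop :=
  let D := [set t : R | 0 <= t /\ (t%:E < eps)%E] in
  [/\ {within D, continuous psi},
      convex_function D (fun t => - psi t),
      (forall t, D t -> 0 <= psi t),
      psi 0 = 0 &
      forall t, 0 < t -> (t%:E < eps)%E ->
        [/\ derivable psi t 1, {for t, continuous (derive1 psi : R -> R)} & 0 < derive1 psi t]].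

Definition KL_property (R : realType) (n : nat) (phi : 'rV[R]_n -> \bar R)
    (x : 'rV[R]_n) : Prop :=
  exists (eps : \bar R) (delta : R) (psi : R -> R),
    [/\ (0 < eps)%E, 0 < delta, desingularizing eps psi &
        forall z, ball2 x delta z -> (phi x < phi z)%E ->
          (phi z < phi x + eps)%E ->
          (1 <= (derive1 psi (fine (phi z - phi x)))%:E
                * dist 0 (lim_subdiff phi z))%E].

Definition KL_function (R : realType) (n : nat) (phi : 'rV[R]_n -> \bar R) :
    Prop :=
  proper_fun phi /\
  forall x, lim_subdiff phi x !=set0 -> KL_property phi x.

Definition Omega (R : realType) (n : nat) (g : 'rV[R]_n -> R) :
    set 'rV[R]_n :=
  [set x | g x != 0].

Definition objective (R : realType) (n : nat) (f g h : 'rV[R]_n -> R)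
    (C : set 'rV[R]_n) (x : 'rV[R]_n) : \bar R :=
  if x \in Omega g `&` C then (f x / g x + h x)%:E else +oo%E.

Definition Qfun (R : realType) (n : nat) (f g h1 h2 : 'rV[R]_n -> R)
    (C : set 'rV[R]_n) (x y z : 'rV[R]_n) (c : R) : \bar R :=
  if (conj_fun g y < +oo)%E && (conj_fun h2 z < +oo)%E then
    (indic_ext R C x + (2 * c * f x)%:E
     + (c ^+ 2 * f x)%:E * (conj_fun g y - (dot x y)%:E)
     + (h1 x)%:E + conj_fun h2 z - (dot x z)%:E)%E
  else +oo%E.

(* [Qfun] as a function on one Euclidean space: R^n * R^n * R^n * R is
   identified with R^(n + (n + (n + 1))) by concatenation of coordinates. *)
Definition Qvec (R : realType) (n : nat) (f g h1 h2 : 'rV[R]_n -> R)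
    (C : set 'rV[R]_n) (w : 'rV[R]_(n + (n + (n + 1)))) : \bar R :=
  Qfun f g h1 h2 C
    (lsubmx w) (lsubmx (rsubmx w)) (lsubmx (rsubmx (rsubmx w)))
    (rsubmx (rsubmx (rsubmx w)) 0 0).

(* A set rather than a point: the proximal operator of the nonconvex function
   [f + indic_ext R C] is set-valued. *)
Definition ampda_trial (R : realType) (n : nat) (f g h1 : 'rV[R]_n -> R)
    (C : set 'rV[R]_n) (x y z : 'rV[R]_n) (a : R) : set 'rV[R]_n :=
  let c := 1 / g x in
  prox (fun u => ((a * c)%:E * ((f u)%:E + indic_ext R C u))%E)
       (x - a *: (grad h1 x - z - (c ^+ 2 * f x) *: y)).

Definition ampda_accept (R : realType) (n : nat) (f g h h1 h2 : 'rV[R]_n -> R)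
    (C : set 'rV[R]_n) (sigma : R) (x y z xhat : 'rV[R]_n) : Prop :=
  Omega g xhat /\
  (Qfun f g h1 h2 C xhat y z (1 / g xhat)
   + (sigma / 2 * norm2 (xhat - x) ^+ 2)%:E <= objective f g h C x)%E.

(* One outer iteration, from [x] to [x'], recording the step size [a]: the trial
   points [xhat 0], ..., [xhat j] of the line search use the step sizes
   [a0 * gamma ^+ i], and [xhat j] is the first one accepted. *)
Definition ampda_step (R : realType) (n : nat) (f g h h1 h2 : 'rV[R]_n -> R)
    (C : set 'rV[R]_n) (alo ahi sigma gamma : R)
    (x y z : 'rV[R]_n) (a : R) (x' : 'rV[R]_n) : Prop :=
  [/\ cvx_subdiff g x y, cvx_subdiff h2 x z &
    exists (a0 : R) (j : nat) (xhat : nat -> 'rV[R]_n),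
      [/\ alo <= a0 <= ahi,
          forall i, (i <= j)%N ->
            ampda_trial f g h1 C x y z (a0 * gamma ^+ i) (xhat i),
          forall i, (i < j)%N ->
            ~ ampda_accept f g h h1 h2 C sigma x y z (xhat i),
          ampda_accept f g h h1 h2 C sigma x y z (xhat j) &
          x' = xhat j /\ a = a0 * gamma ^+ j]].

Definition ampda_run (R : realType) (n : nat) (f g h h1 h2 : 'rV[R]_n -> R)
    (C : set 'rV[R]_n) (alo ahi sigma gamma : R) (x0 : 'rV[R]_n)
    (x y z : nat -> 'rV[R]_n) (alpha : nat -> R) : Prop :=
  x 0%N = x0 /\
  forall k, ampda_step f g h h1 h2 C alo ahi sigma gamma
              (x k) (y k) (z k) (alpha k) (x k.+1).

Definition critical_point (R : realType) (n : nat)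
    (f g h1 h2 : 'rV[R]_n -> R) (C : set 'rV[R]_n) (x : 'rV[R]_n) : Prop :=
  let c := 1 / g x in
  Omega g x /\
  exists u v w : 'rV[R]_n,
    [/\ frechet_subdiff (fun t => ((c * f t)%:E + indic_ext R C t)%E) x u,
        cvx_subdiff g x v, cvx_subdiff h2 x w &
        0 = u - (c ^+ 2 * f x) *: v + grad h1 x - w].

(* Main.v *)
Require Import Defs.
From HB Require Import structures.
From mathcomp Require Import all_boot all_order all_algebra.
From mathcomp Require Import all_classical all_reals all_analysis.
From mathcomp Require Import ring lra.

(* By Fenchel's equality Q(x^(k+1), y^k, z^k, 1/g(x^(k+1))) lies between
   F(x^(k+1)) and F(x^k) - (sigma/2) |x^(k+1) - x^k|^2, so Q decreases along
   w^k = (x^(k+1), y^k, z^k, 1/g(x^(k+1))).  The line search accepts every small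
   enough step because 2c' - c'^2 g(x) - c = -c (1 - c' g(x))^2 <= 0 for c = 1/g(x),
   c' = 1/g(x'), so the step sizes stay away from 0 and the optimality condition
   of the proximal step provides a Frechet subgradient of Q at w^k of norm
   O(|x^(k+1) - x^k|).  The y^k and z^k need not converge, so the KL inequality
   is needed near all the cluster points of (w^k) at once: they are covered by
   finitely many KL balls, whose desingularizing functions are added.  The path
   then has finite length, and criticality of the limit is obtained by passing to
   the limit in the minimality property of the proximal step. *)

Set Implicit Arguments.
Unset Strict Implicit.
Unset Printing Implicit Defensive.

Import Order.TTheory GRing.Theory Num.Theory.
Import numFieldNormedType.Exports.

Local Open Scope classical_set_scope.
Local Open Scope ring_scope.

(** * Euclidean and sup norms *)

(** Frechet subdifferentials have neither an exact sum rule nor a closed graph, and [critical_point]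
    asks for a Frechet subgradient. So every Frechet subgradient is carried by a quadratic minorant:
    minimality in the proximal step is one for [f] on [C], and such minorants can be added,
    multiplied by a nonnegative coefficient, and passed to the limit when their constants are
    uniform. The O(|x^(k+1) - x^k|) bound rests on the choice c' = 1/g(x^(k+1)), a zero of the
    derivative of c |-> 2c - c^2 g(x^(k+1)): the derivative of Q in c nearly vanishes at w^k, and
    the coefficient of f in Q, times g(x^k), is nearly 1, which cancels the factor g(x^k) coming
    from the proximal step. The indices are shifted: the subgradient at w^k is controlled by D_k =
    |x^(k+1) - x^k|, but Q drops from w^k to w^(k+1) by a multiple of D_(k+1)^2. The KL inequality
    therefore bounds D_(k+1) by D_k / 2 plus a telescoping term, and the factor 1/2 makes the sum
    finite. Estimates are made in the sup norm, at the price of factors n. *)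

Section Euclidean.
Context {R : realType} {n : nat}.
Implicit Types (x y z : 'rV[R]_n) (a r : R).

Lemma dotC x y : dot x y = dot y x.
Proof. by apply: eq_bigr => i _; rewrite mulrC. Qed.

Lemma dotDl x y z : dot (x + y) z = dot x z + dot y z.
Proof. by rewrite -big_split; apply: eq_bigr => i _; rewrite mxE mulrDl. Qed.

Lemma dotZl a x y : dot (a *: x) y = a * dot x y.
Proof. by rewrite mulr_sumr; apply: eq_bigr => i _; rewrite mxE mulrA. Qed.

Lemma dotNl x y : dot (- x) y = - dot x y.
Proof. by rewrite -scaleN1r dotZl mulN1r. Qed.

Lemma dotBl x y z : dot (x - y) z = dot x z - dot y z.
Proof. by rewrite dotDl dotNl. Qed.

Lemma dotDr x y z : dot x (y + z) = dot x y + dot x z.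
Proof. by rewrite dotC dotDl !(dotC x). Qed.

Lemma dotZr a x y : dot x (a *: y) = a * dot x y.
Proof. by rewrite dotC dotZl dotC. Qed.

Lemma dotNr x y : dot x (- y) = - dot x y.
Proof. by rewrite dotC dotNl dotC. Qed.

Lemma dotBr x y z : dot x (y - z) = dot x y - dot x z.
Proof. by rewrite dotDr dotNr. Qed.

Lemma dot0r x : dot x 0 = 0.
Proof. by rewrite -(scale0r x) dotZr mul0r. Qed.

Lemma coord_le_norm x i : `|x 0 i| <= `|x|.
Proof.
rewrite [leRHS]/Num.Def.normr /= mx_normrE; apply/bigmax_geP; right.
by exists (0, i).
Qed.

Lemma norm_le_coord x r : 0 <= r -> (forall i, `|x 0 i| <= r) -> `|x| <= r.
Proof.
move=> r0 xr; rewrite [leLHS]/Num.Def.normr /= mx_normrE; apply: bigmax_le => //.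
by move=> [i j] _ /=; rewrite ord1.
Qed.

Lemma dot_le x y : `|dot x y| <= n%:R * `|x| * `|y|.
Proof.
apply: le_trans (ler_norm_sum _ _ _) _.
have -> : n%:R * `|x| * `|y| = \sum_(i < n) `|x| * `|y|.
  by rewrite sumr_const card_ord -mulrA mulr_natl.
by apply: ler_sum => i _; rewrite normrM ler_pM ?coord_le_norm.
Qed.

Lemma dot_ge0 x : 0 <= dot x x.
Proof. by apply: sumr_ge0 => i _; rewrite -expr2 sqr_ge0. Qed.

Lemma sqr_norm2 x : norm2 x ^+ 2 = dot x x.
Proof. by rewrite sqr_sqrtr ?dot_ge0. Qed.

Lemma norm2_ge0 x : 0 <= norm2 x.
Proof. exact: sqrtr_ge0. Qed.

Lemma norm_le_norm2 x : `|x| <= norm2 x.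
Proof.
apply: norm_le_coord (norm2_ge0 _) _ => i.
rewrite -sqrtr_sqr ler_sqrt ?dot_ge0// /dot (bigD1 i)//= -expr2 lerDl.
by apply: sumr_ge0 => j _; rewrite -expr2 sqr_ge0.
Qed.

Lemma norm2_le x : norm2 x <= n%:R * `|x|.
Proof.
rewrite -[leRHS]ger0_norm ?mulr_ge0// -sqrtr_sqr ler_sqrt ?sqr_ge0//.
apply: le_trans (ler_norm _) _; apply: le_trans (dot_le _ _) _.
rewrite exprMn -mulrA -expr2 ler_wpM2r ?sqr_ge0// -natrX ler_nat.
by case: n => // m; rewrite leq_pmulr.
Qed.

Lemma norm2B x y : norm2 (x - y) = norm2 (y - x).
Proof. by rewrite /norm2 -opprB dotNl dotNr opprK. Qed.

Lemma norm2_gt0 x : x != 0 -> 0 < norm2 x.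
Proof. by move=> x0; apply: lt_le_trans (norm_le_norm2 _); rewrite normr_gt0. Qed.

Lemma norm2_0 : norm2 (0 : 'rV[R]_n) = 0.
Proof. by rewrite /norm2 dot0r sqrtr0. Qed.

Lemma ball2_norm x z r : n%:R * `|z - x| < r -> ball2 x r z.
Proof. exact: le_lt_trans (norm2_le _). Qed.

Lemma nbhs_ball2 x r : 0 < r -> nbhs x (ball2 x r).
Proof.
move=> r0; apply/nbhs_ballP; exists (r / n.+1%:R) => /=; first exact: divr_gt0.
move=> z; rewrite -ball_normE /ball_ /= distrC ltr_pdivlMr// => zx.
apply: ball2_norm; apply: le_lt_trans zx.
by rewrite mulrC ler_wpM2l// ler_nat.
Qed.

End Euclidean.

Lemma nbhs_dist (R : realType) (V : normedModType R) (x : V) (P : set V) :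
  nbhs x P <-> exists2 r : R, 0 < r & forall z, `|z - x| < r -> P z.
Proof.
rewrite nbhs_ballP; split=> -[r r0 xP]; exists r => // z zx; apply: xP.
  by rewrite -ball_normE /ball_ /= distrC.
by move: zx; rewrite -ball_normE /ball_ /= distrC.
Qed.

(** * Convex functions *)

Section ConvexFunction.
Context {R : realType} {n : nat}.
Variable g : 'rV[R]_n -> R.
Hypothesis g_cvx : convex_function setT g.
Implicit Types (u v x y t : 'rV[R]_n) (r M : R).

Lemma convex_comb (a : R) u v : 0 <= a <= 1 ->
  g (a *: u + (1 - a) *: v) <= a * g u + (1 - a) * g v.
Proof.
move=> /andP[a0 a1].
have := g_cvx (Itv01 a0 a1) (x := u) (y := v).
by apply; rewrite in_setT.
Qed.

Lemma convex_comb_le_max (a : R) u v : 0 <= a <= 1 ->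
  g (a *: u + (1 - a) *: v) <= Num.max (g u) (g v).
Proof.
move=> a01; apply: le_trans (convex_comb _ _ a01) _.
have gu : g u <= Num.max (g u) (g v) by rewrite le_max lexx.
have gv : g v <= Num.max (g u) (g v) by rewrite le_max lexx orbT.
by move/andP: a01 => [a0 a1]; nra.
Qed.

(* Induction on the number [j] of coordinates that are allowed to move: a point
   of the cube lies between two points of opposite faces. *)
Lemma convex_bounded_on_cube x r : 0 < r ->
  exists M, forall t, `|t| <= r -> g (x + t) <= M.
Proof.
move=> r0.
suff /(_ n x)[M gM] : forall j x, exists M, forall t, `|t| <= r ->
    (forall i : 'I_n, (j <= i)%N -> t 0 i = 0) -> g (x + t) <= M.
  by exists M => t tr; apply: gM => // i; rewrite leqNgt ltn_ord.
elim=> [|j IH] {}x.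
  exists (g x) => t _ t0; suff -> : t = 0 by rewrite addr0.
  by apply/rowP => i; rewrite t0// mxE.
have [jn|nj] := ltnP j n; last first.
  have [M gM] := IH x; exists M => t tr _; apply: gM => // i ji.
  by have := leq_trans nj ji; rewrite leqNgt ltn_ord.
pose e : 'rV[R]_n := delta_mx 0 (Ordinal jn).
have [M1 gM1] := IH (x + r *: e); have [M2 gM2] := IH (x - r *: e).
exists (Num.max M1 M2) => t tr t0.
pose tj := t 0 (Ordinal jn); pose t' := t - tj *: e.
have tjr : - r <= tj <= r.
  by rewrite -ler_norml; apply: le_trans tr; apply: coord_le_norm.
have t'E i : t' 0 i = if i == Ordinal jn then 0 else t 0 i.
  rewrite !mxE eqxx /=; case: eqP => [->|_]; first by rewrite mulr1 subrr.
  by rewrite mulr0 subr0.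
have t'r : `|t'| <= r.
  apply: norm_le_coord (ltW r0) _ => i; rewrite t'E; case: ifP => _.
    by rewrite normr0 ltW.
  exact: le_trans (coord_le_norm _ _) tr.
have t'0 (i : 'I_n) : (j <= i)%N -> t' 0 i = 0.
  rewrite t'E leq_eqVlt => /predU1P[ji|/t0 ->]; last by case: ifP.
  by case: eqP => // -[]; apply: val_inj.
pose a := (tj + r) / (2 * r).
have a01 : 0 <= a <= 1.
  move/andP: tjr => [tj1 tj2].
  by rewrite /a divr_ge0 ?ler_pdivrMr; lra.
have -> : x + t = a *: (x + r *: e + t') + (1 - a) *: (x - r *: e + t').
  have tjE : tj = a * r - (1 - a) * r by rewrite /a; field; lra.
  apply/rowP => i; rewrite !mxE.
  rewrite -/tj.
  by rewrite tjE /=; ring.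
apply: le_trans (convex_comb_le_max _ _ a01) _.
by rewrite ge_max !le_max gM1// gM2// orbT.
Qed.

(** Bounded above on the cube of radius 2, [g] is bounded below there by reflection through [x];
    prolonging the segment from [u] beyond [v] by length 1 then bounds the slope. Radius 2 leaves
    room for the prolonged point [w] when [v] is within 1 of [x]. *)
Lemma convex_locally_lipschitz x : exists r M, [/\ 0 < r, 0 <= M &
  forall u v, `|u - x| <= r -> `|v - x| <= r -> `|g u - g v| <= M * `|u - v|].
Proof.
have [M gM] := convex_bounded_on_cube x (ltr0n R 2).
have gxM : g x <= M by rewrite -[x]addr0 gM// normr0.
have lb u : `|u - x| <= 2 -> 2 * g x - M <= g u.
  move=> ux.
  have := @convex_comb 2^-1 u (x - (u - x)).
  have -> : 2^-1 *: u + (1 - 2^-1) *: (x - (u - x)) = x.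
    by apply/rowP => i; rewrite !mxE; lra.
  have := gM (- (u - x)); rewrite normrN => /(_ ux).
  by move=> h1 /(_ _); lra.
have ub u : `|u - x| <= 2 -> g u <= M.
  by move=> /gM; rewrite addrC subrK.
have half u v : `|u - x| <= 1 -> `|v - x| <= 1 ->
    g v - g u <= 2 * (M - g x) * `|u - v|.
  move=> ux vx; have [->|uv] := eqVneq u v; first by rewrite !subrr normr0 mulr0.
  pose s := `|v - u|; have s0 : 0 < s by rewrite normr_gt0 subr_eq0 eq_sym.
  pose w := v + s^-1 *: (v - u).
  have wx : `|w - x| <= 2.
    have -> : w - x = (v - x) + s^-1 *: (v - u) by rewrite /w addrAC.
    apply: le_trans (ler_normD _ _) _.
    rewrite normrZ gtr0_norm ?invr_gt0// -/s mulVf ?gt_eqF//.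
    by lra.
  have u2 : `|u - x| <= 2 by lra.
  have a01 : 0 <= s / (1 + s) <= 1.
    by rewrite divr_ge0 ?ler_pdivrMr; lra.
  have vE : v = (s / (1 + s)) *: w + (1 - s / (1 + s)) *: u.
    by apply/rowP => i; rewrite !mxE; field; lra.
  have := convex_comb w u a01; rewrite -vE => gv.
  have := ub _ wx; have := lb _ u2 => gu gw.
  rewrite distrC -/s.
  have a_le : s / (1 + s) <= s by rewrite ler_pdivrMr; nra.
  move: (s / (1 + s)) a_le a01 gv => a a_le /andP[a0 a1] gv.
  by nra.
exists 1, (2 * (M - g x)); split; [by []|by lra|] => u v ux vx.
rewrite ler_norml; have := half _ _ ux vx; have := half _ _ vx ux.
by rewrite (distrC v); lra.
Qed.

(** Testing the subgradient inequality at [u] plus or minus [s] times a basis vector bounds each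
    coordinate of [y]; basis vectors have sup norm at most 1, so [M] is kept without a factor n. *)
Lemma subgradient_le x u y r M : 0 < r -> 0 <= M ->
  (forall v, `|v - x| <= r -> `|g v - g u| <= M * `|v - u|) ->
  `|u - x| < r -> cvx_subdiff g u y -> `|y| <= M.
Proof.
move=> r0 M0 gM ux gy; apply: norm_le_coord => // i.
pose s := r - `|u - x|; have s0 : 0 < s by rewrite subr_gt0.
have ei : `|delta_mx 0 i : 'rV[R]_n| <= 1.
  apply: norm_le_coord => // j; rewrite mxE /=.
  by case: eqP => _; rewrite ?normr1 ?normr0.
have key a : `|a| = s -> a * y 0 i <= M * s.
  move=> a_s; pose v := u + a *: delta_mx 0 i.
  have vuE : v - u = a *: delta_mx 0 i by rewrite /v addrC addKr.
  have vu : `|v - u| <= s.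
    by rewrite vuE normrZ a_s ler_piMr// ltW.
  have vx : `|v - x| <= r.
    have -> : v - x = (v - u) + (u - x) by rewrite addrA subrK.
    by apply: le_trans (ler_normD _ _) _; rewrite /s in vu; lra.
  have := le_trans (ler_norm _) (gM _ vx).
  have := gy v; rewrite [in dot _ _]vuE dotZr.
  have -> : dot y (delta_mx 0 i) = y 0 i.
    rewrite /dot (bigD1 i)//= mxE !eqxx mulr1 big1 ?addr0// => j ji.
    by rewrite mxE eqxx (negbTE ji) mulr0.
  have : M * `|v - u| <= M * s by rewrite ler_wpM2l.
  lra.
have := key s (ger0_norm (ltW s0)).
have : `|- s| = s by rewrite normrN ger0_norm ?ltW.
move=> /key; rewrite ler_norml mulNr.
by move=> h1 h2; rewrite -(ler_pM2r s0 (y 0 i)) -(ler_pM2r s0 (- M)); lra.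
Qed.

End ConvexFunction.

(** * First-order expansion *)

Section FirstOrderExpansion.
Context {R : realType} {n : nat}.
Variable h : 'rV[R]_n -> R.
Implicit Types (u v x d : 'rV[R]_n).

Lemma derive_grad u d : differentiable h u -> 'D_d h u = dot (grad h u) d.
Proof.
move=> dh; rewrite deriveE// {1}(row_sum_delta d) linear_sum.
by apply: eq_bigr => i _; rewrite linearZ /= mxE deriveE// mulrC.
Qed.

Lemma is_derive_line u d (t : R) : differentiable h (t *: d + u) ->
  is_derive t 1 (fun s : R => h (s *: d + u)) (dot (grad h (t *: d + u)) d).
Proof.
move=> dh.
pose l := ( *:%R^~ d + cst u : R -> 'rV[R]_n).
have dl : is_diff t l ( *:%R^~ d + 0) by exact: is_diffD.
have dphi : differentiable (h \o l) t.
  exact: differentiable_comp.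
suff : is_derive t 1 (h \o l) (dot (grad h (t *: d + u)) d) by [].
apply: DeriveDef; first exact: diff_derivable.
rewrite deriveE// diff_comp//.
by rewrite /= diff_val /= addr0 scale1r -deriveE// derive_grad.
Qed.

(** The mean value theorem on the segment produces the gradient at one intermediate point, which is
    compared with the gradient at [u]; the factor n comes from [dot_le]. *)
Lemma first_order_expansion x (r L : R) : 0 <= L ->
  (forall u, `|u - x| < r -> differentiable h u) ->
  (forall u v, `|u - x| < r -> `|v - x| < r ->
     `|grad h u - grad h v| <= L * `|u - v|) ->
  forall u v, `|u - x| < r -> `|v - x| < r ->
    `|h v - h u - dot (grad h u) (v - u)| <= n%:R * L * `|v - u| ^+ 2.
Proof.
move=> L0 dh gL u v ux vx; pose d := v - u.
have seg (t : R) : t \in `[0, 1] -> `|t *: d + u - x| < r.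
  rewrite in_itv /= => /andP[t0 t1].
  have -> : t *: d + u - x = t *: (v - x) + (1 - t) *: (u - x).
    by apply/rowP => i; rewrite !mxE; ring.
  apply: le_lt_trans (ler_normD _ _) _.
  rewrite !normrZ !ger0_norm ?subr_ge0//.
  have [->|t_neq0] := eqVneq t 0; first by lra.
  have tgt0 : 0 < t by rewrite lt_def t_neq0.
  by move: (`|v - x|) (`|u - x|) vx ux => a b ar br; nra.
have dphi (t : R) : t \in `[0, 1] ->
    is_derive t 1 (fun s : R => h (s *: d + u)) (dot (grad h (t *: d + u)) d).
  by move=> /seg tx; apply/is_derive_line/dh.
have dphi' (t : R) : t \in `]0, 1[ ->
    is_derive t 1 (fun s : R => h (s *: d + u)) (dot (grad h (t *: d + u)) d).
  by rewrite in_itv /= => /andP[/ltW t0 /ltW t1]; apply: dphi; rewrite in_itv /= t0.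
have cphi : {within `[0, 1], continuous (fun s : R => h (s *: d + u))}.
  by apply: derivable_within_continuous => t /dphi dt; exact: ex_derive.
have [t t01] := MVT_segment ler01 dphi' cphi.
rewrite scale0r scale1r add0r {1}/d subrK subr0 mulr1 => ->.
rewrite -dotBl; apply: le_trans (dot_le _ _) _.
rewrite -/d expr2 -!mulrA ler_wpM2l// !mulrA ler_wpM2r//.
apply: le_trans (gL _ _ (seg _ t01) ux) _.
rewrite addrK normrZ; have := t01; rewrite in_itv /= => /andP[t0 t1].
by rewrite ger0_norm// ler_wpM2l// ler_piMl.
Qed.

End FirstOrderExpansion.

(** * Uniform bounds on the level set *)

Section LocalBounds.
Context {R : realType} {n : nat}.
Variables f g h1 h2 : 'rV[R]_n -> R.
Implicit Types (u v x y z : 'rV[R]_n) (M : R).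

(* A single constant M bounds everything, and M^-1 is also the radius on which
   the estimates hold, so that the bounds survive any increase of M. *)
Record bounds_around M u x : Prop := BoundsAround {
  around_g_gt0 : 0 < g u;
  around_gV : (g u)^-1 <= M;
  around_f : `|f u - f x| <= M * `|u - x|;
  around_g : `|g u - g x| <= M * `|u - x|;
  around_h2 : `|h2 u - h2 x| <= M * `|u - x|;
  around_grad : `|grad h1 u - grad h1 x| <= M * `|u - x|;
  around_h1 :
    `|h1 u - h1 x - dot (grad h1 x) (u - x)| <= M * `|u - x| ^+ 2 }.

Record local_bounds M x : Prop := LocalBounds {
  bound_f : f x <= M;
  bound_grad : `|grad h1 x| <= M;
  bound_subdiff_g : forall y, cvx_subdiff g x y -> `|y| <= M;
  bound_subdiff_h2 : forall z, cvx_subdiff h2 x z -> `|z| <= M;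
  bound_around : forall u, `|u - x| <= M^-1 -> bounds_around M u x }.

Hypothesis g_ge0 : forall x, 0 <= g x.
Hypothesis f_lip : locally_lipschitz (Omega g) f.
Hypothesis g_cvx : convex_function setT g.
Hypothesis h1_diff : locally_lipschitz_differentiable (Omega g) h1.
Hypothesis h2_cvx : convex_function setT h2.

(** Holding for every [M] above a threshold is what allows finitely many of these neighborhoods to
    share one constant on a compact set. *)
Lemma local_bounds_near x : Omega g x -> exists M0,
  \forall x' \near x, forall M, M0 <= M -> local_bounds M x'.
Proof.
move=> gx; have gx0 : 0 < g x by rewrite lt_def gx g_ge0.
have [rg [Mg [rg0 Mg0 gL]]] := convex_locally_lipschitz g_cvx x.
have [rh [Mh [rh0 Mh0 hL]]] := convex_locally_lipschitz h2_cvx x.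
have [rf [Lf [rf0 fL]]] := f_lip gx.
have [r1 [L1 [r10 h1d h1L]]] := h1_diff gx.
pose N : R := n%:R; have N0 : 0 <= N by rewrite /N.
(* The Lipschitz constants of the hypotheses come without a sign, hence the absolute value; [N]
   converts the Euclidean norm to the sup norm. *)
pose Kf := `|Lf| * N; have Kf0 : 0 <= Kf by rewrite mulr_ge0.
pose K1 := `|L1| * N; have K10 : 0 <= K1 by rewrite mulr_ge0.
have /nbhs_dist[r2 r20 B2] := nbhs_ball2 x rf0.
have /nbhs_dist[r3 r30 B3] := nbhs_ball2 x r10.
(* Within this radius [g] varies by at most [g x / 2]; the [+ 1] covers [Mg = 0]. *)
pose r4 := g x / (2 * (Mg + 1)).
have r40 : 0 < r4 by rewrite divr_gt0//; lra.
have [rho [rho0 [lg lh l2 l3 l4]]] : exists rho : R, 0 < rho /\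
    [/\ rho <= rg, rho <= rh, rho <= r2, rho <= r3 & rho <= r4].
  exists (Num.min rg (Num.min rh (Num.min r2 (Num.min r3 r4)))).
  by rewrite !lt_min !ge_min !lexx ?orbT; split => //; apply/and5P.
have Lnorm2 (L : R) u v : L * norm2 (u - v) <= `|L| * N * `|u - v|.
  apply: le_trans (_ : `|L| * norm2 (u - v) <= _).
    by rewrite ler_wpM2r ?norm2_ge0// ler_norm.
  by rewrite -mulrA ler_wpM2l// norm2_le.
have gpos u : `|u - x| < rho -> g x / 2 <= g u.
  move=> ux; have := gL u x; rewrite subrr normr0.
  move=> /(_ (ltW (lt_le_trans ux lg)) (ltW rg0)); rewrite ler_norml.
  have : Mg * `|u - x| <= g x / 2.
    apply: le_trans (_ : (Mg + 1) * r4 <= _).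
      by apply: ler_pM => //; [lra|apply: ltW; apply: lt_le_trans ux _].
    by rewrite /r4 le_eqVlt; apply/orP; left; apply/eqP; field; lra.
  by lra.
have Om u : `|u - x| < rho -> Omega g u.
  by move=> /gpos gu; rewrite /Omega /= gt_eqF//; lra.
have fLs u v : `|u - x| < rho -> `|v - x| < rho -> `|f u - f v| <= Kf * `|u - v|.
  move=> ux vx; apply: le_trans (Lnorm2 _ _ _); apply: fL; split.
  - exact/B2/(lt_le_trans ux).
  - exact: Om.
  - exact/B2/(lt_le_trans vx).
  - exact: Om.
have h1Ls u v : `|u - x| < rho -> `|v - x| < rho ->
    `|grad h1 u - grad h1 v| <= K1 * `|u - v|.
  move=> ux vx; apply: le_trans (Lnorm2 _ _ _).
  apply: le_trans (norm_le_norm2 _) _; apply: h1L.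
  - exact/B3/(lt_le_trans ux).
  - exact/B3/(lt_le_trans vx).
have h1ds u : `|u - x| < rho -> differentiable h1 u.
  by move=> ux; apply/h1d/B3/(lt_le_trans ux).
have expand := first_order_expansion K10 h1ds h1Ls.
exists (Num.max 1 (Num.max (2 / g x) (Num.max Mg (Num.max Mh (Num.max Kf
  (Num.max (`|f x| + Kf * rho) (Num.max K1 (Num.max (`|grad h1 x| + K1 * rho)
  (Num.max (N * K1) (4 / rho)))))))))).
(* The entry [4 / rho] of the maximum gives [M^-1 <= rho / 4], so a point within [M^-1] of [x']
   stays within [rho] of [x], where all the estimates hold. *)
apply/nbhs_dist; exists (rho / 2); first by rewrite divr_gt0.
move=> x' xx' M; rewrite !ge_max => /andP[M1 /andP[MgV /andP[MgM /andP[MhM /andP[KfM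
  /andP[MfM /andP[K1M /andP[M1M /andP[NM Mrho]]]]]]]]].
have M0p : 0 < M by apply: lt_le_trans M1.
have MV : M^-1 <= rho / 4.
  rewrite -[rho / 4]invrK lef_pV2 ?posrE ?invr_gt0 ?divr_gt0// invf_div.
  by [].
have x'rho : `|x' - x| < rho by lra.
have xrho : `|x - x| < rho by rewrite subrr normr0.
have x'rg : `|x' - x| < rg := lt_le_trans x'rho lg.
have x'rh : `|x' - x| < rh := lt_le_trans x'rho lh.
have Mle (K c : R) : K <= M -> 0 <= c -> K * c <= M * c.
  by move=> KM c0; rewrite ler_wpM2r.
have Krho (K : R) : 0 <= K -> K * `|x' - x| <= K * rho.
  by move=> K0; rewrite ler_wpM2l// ltW.
split.
- apply: le_trans MfM; rewrite -[leLHS](subrK (f x)) addrC lerD ?ler_norm//.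
  by apply: le_trans (ler_norm _) (le_trans (fLs _ _ x'rho xrho) (Krho _ Kf0)).
- apply: le_trans M1M; rewrite -[grad h1 x'](subrK (grad h1 x)).
  rewrite addrC (le_trans (ler_normD _ _))// lerD2l.
  exact: le_trans (h1Ls _ _ x'rho xrho) (Krho _ K10).
- move=> y gy; apply: le_trans MgM.
  apply: (subgradient_le rg0 Mg0 _ x'rg gy) => v vx.
  by apply: gL => //; apply: ltW.
- move=> z hz; apply: le_trans MhM.
  apply: (subgradient_le rh0 Mh0 _ x'rh hz) => v vx.
  by apply: hL => //; apply: ltW.
move=> u ux'.
have urho : `|u - x| < rho.
  rewrite -(subrK x' u) -addrA; apply: le_lt_trans (ler_normD _ _) _.
  by lra.
have gu := gpos _ urho; have gx2 : 0 < g x / 2 by exact: divr_gt0.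
split.
- exact: lt_le_trans gu.
- apply: le_trans MgV; rewrite -invf_div lef_pV2// posrE.
  exact: lt_le_trans gu.
- by apply: le_trans (fLs _ _ urho x'rho) _; apply: Mle.
- apply: le_trans (gL _ _ (ltW (lt_le_trans urho lg)) (ltW x'rg)) _.
  exact: Mle.
- apply: le_trans (hL _ _ (ltW (lt_le_trans urho lh)) (ltW x'rh)) _.
  exact: Mle.
- by apply: le_trans (h1Ls _ _ urho x'rho) _; apply: Mle.
- apply: le_trans (expand _ _ x'rho urho) _.
  by apply: Mle; rewrite ?sqr_ge0.
Qed.

Lemma compact_local_bounds (X : set 'rV[R]_n) : compact X -> X `<=` Omega g ->
  exists M, 1 <= M /\ forall x, X x -> local_bounds M x.
Proof.
move=> /compact_near_coveringP X_cov XO.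
suff /X_cov[M1 [_ M1X]] : forall x, X x ->
    \forall x' \near x & M \near +oo, local_bounds M x'.
  pose M := Num.max (M1 + 1) 1; exists M; split.
    by rewrite le_max lexx orbT.
  move=> x; apply: (M1X M).
  by rewrite lt_max ltrDl ltr01.
move=> x /XO /local_bounds_near[M0 M0P].
near=> x' M.
have : M0 <= M by near: M; apply: nbhs_pinfty_ge; rewrite num_real.
by apply: (near M0P x').
Unshelve. all: end_near. Qed.

End LocalBounds.

(** * Line search *)

Section Conjugate.
Context {R : realType} {n : nat}.
Implicit Types (u v x y z : 'rV[R]_n).

Lemma conj_fun_subgradient (g : 'rV[R]_n -> R) x y : cvx_subdiff g x y ->
  conj_fun g y = (dot x y - g x)%:E.
Proof.
move=> gy; apply/eqP; rewrite eq_le; apply/andP; split.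
  apply: ge_ereal_sup => _ [u _ <-]; rewrite lee_fin.
  by have := gy u; rewrite dotBr (dotC u) (dotC x); lra.
by apply: ereal_sup_ubound; exists x.
Qed.

Lemma conj_fun_ge (g : 'rV[R]_n -> R) x y : ((dot x y - g x)%:E <= conj_fun g y)%E.
Proof. by apply: ereal_sup_ubound; exists x. Qed.

Variables f g h1 h2 : 'rV[R]_n -> R.
Variable C : set 'rV[R]_n.

(* The value of Q(u, y, z, c) when y and z are subgradients at x, where
   Fenchel's equality evaluates both conjugates. *)
Definition Qval x y z u (c : R) : R :=
  2 * c * f u - c ^+ 2 * f u * (g x + dot y (u - x)) + h1 u - h2 x
  - dot z (u - x).

Lemma Qfun_subgradient x y z u c : cvx_subdiff g x y -> cvx_subdiff h2 x z ->
  C u -> Qfun f g h1 h2 C u y z c = (Qval x y z u c)%:E.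
Proof.
move=> gy hz Cu; rewrite /Qfun (conj_fun_subgradient gy) (conj_fun_subgradient hz).
rewrite !ltry /= /indic_ext mem_set// add0e.
rewrite -!(EFinB, EFinM, EFinD); congr (_%:E).
by rewrite /Qval !dotBr !(dotC u) !(dotC x); ring.
Qed.

(** The gradient at [x] of h1 - <z, .> - c^2 f(x) <y, .> with c = 1/g(x), the explicit part of the
    proximal step. *)
Definition gradient_step x y z : 'rV[R]_n :=
  grad h1 x - z - ((1 / g x) ^+ 2 * f x) *: y.

(** Expanding the square in [prox] and dividing by [a] leaves a model of the objective; the term in
    [dot v v] is common to both sides. Comparison with [x], a point of [C], forces [u] into [C]. *)
Lemma trial_min x y z a u : 0 < a -> 0 < g x -> C x ->
  ampda_trial f g h1 C x y z a u ->
  C u /\ forall w, C w ->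
    1 / g x * f u + dot (gradient_step x y z) (u - x)
      + (2 * a)^-1 * norm2 (u - x) ^+ 2
    <= 1 / g x * f w + dot (gradient_step x y z) (w - x)
      + (2 * a)^-1 * norm2 (w - x) ^+ 2.
Proof.
move=> a0 gx0 Cx; rewrite /ampda_trial /prox /= => umin.
have Cu : C u.
  apply: contrapT => Cu; have := umin x.
  rewrite /indic_ext (memNset Cu) (mem_set Cx) addey// gt0_muley ?lte_fin.
    by rewrite addye// adde0 -EFinM -EFinD leye_eq.
  by rewrite mulr_gt0// divr_gt0.
split=> // w Cw; have := umin w.
rewrite /indic_ext (mem_set Cu) (mem_set Cw) !adde0 -!EFinM -!EFinD lee_fin.
rewrite -/(gradient_step x y z); move: (gradient_step x y z) => v.
have sq t : norm2 (x - a *: v - t) ^+ 2 =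
    norm2 (t - x) ^+ 2 + 2 * a * dot v (t - x) + a ^+ 2 * dot v v.
  have -> : x - a *: v - t = - (t - x + a *: v).
    by apply/rowP => i; rewrite !mxE; ring.
  move: (t - x) => d.
  rewrite !sqr_norm2 dotNl dotNr opprK !(dotDl, dotDr, dotZl, dotZr) (dotC d v).
  by ring.
rewrite !sq => le_uw; rewrite -(ler_pM2l a0).
have E t : a * (1 / g x * f t + dot v (t - x) + (2 * a)^-1 * norm2 (t - x) ^+ 2)
   = a * (1 / g x) * f t + 2^-1 * (norm2 (t - x) ^+ 2 + 2 * a * dot v (t - x)).
  by field; lra.
by rewrite !E; lra.
Qed.

End Conjugate.

Section LineSearch.
Context {R : realType} {n : nat}.
Variables f g h h1 h2 : 'rV[R]_n -> R.
Variable C : set 'rV[R]_n.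
Hypothesis f_ge0 : forall x, 0 <= f x.
Hypothesis hE : forall x, h x = h1 x - h2 x.
Implicit Types (u v x y z : 'rV[R]_n) (M : R).

Lemma local_bounds_center M x : 1 <= M -> local_bounds f g h1 h2 M x ->
  0 < g x /\ (g x)^-1 <= M.
Proof.
move=> M1 /bound_around /(_ x); rewrite subrr normr0 invr_ge0.
by move=> /(_ (le_trans ler01 M1))[].
Qed.

Lemma inv_denominator_bound M x u : 1 <= M -> local_bounds f g h1 h2 M x ->
  `|u - x| <= M^-1 ->
  `|(g u)^-1 - (g x)^-1| <= M ^+ 3 * `|u - x|.
Proof.
move=> M1 xM ux; have [gx0 gxM] := local_bounds_center M1 xM.
have [gu0 guM _ gux _ _ _] := bound_around xM ux.
have -> : (g u)^-1 - (g x)^-1 = (g u)^-1 * (g x)^-1 * (g x - g u).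
  by field; lra.
rewrite distrC in gux; rewrite !normrM.
rewrite (gtr0_norm (_ : 0 < (g u)^-1)) ?(gtr0_norm (_ : 0 < (g x)^-1)) ?invr_gt0//.
have -> : M ^+ 3 * `|u - x| = M * M * (M * `|u - x|) by ring.
apply: ler_pM => //; first by rewrite mulr_ge0// invr_ge0 ltW.
by apply: ler_pM => //; rewrite invr_ge0 ltW.
Qed.

(** The weight f/g^2 of [y] is frozen at [x] in the trial step but is taken at [u] in Q; this
    estimate pays for the change, in the acceptance test and in the subgradient bound. *)
Lemma f_div_sqr_bound M x u : 1 <= M -> local_bounds f g h1 h2 M x ->
  `|u - x| <= M^-1 ->
  `|(g x)^-1 ^+ 2 * f x - (g u)^-1 ^+ 2 * f u|
    <= (M ^+ 3 + 2 * M ^+ 4 * (M + 1)) * `|u - x|.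
Proof.
move=> M1 xM ux; have [gx0 gxM] := local_bounds_center M1 xM.
have inv := inv_denominator_bound M1 xM ux.
have [gu0 guM fux _ _ _ _] := bound_around xM ux.
have M0 : 0 < M by apply: lt_le_trans M1.
have fuM : f u <= M + 1.
  have : M * `|u - x| <= 1 by rewrite -ler_pdivlMl// mulr1.
  by have := bound_f xM; have := ler_norm (f u - f x); lra.
have cx0 : 0 < (g x)^-1 by rewrite invr_gt0.
have cu0 : 0 < (g u)^-1 by rewrite invr_gt0.
move: (g x)^-1 (g u)^-1 cx0 cu0 gxM guM inv => c c' c0 c'0 cM c'M inv.
have -> : c ^+ 2 * f x - c' ^+ 2 * f u =
    - (c ^+ 2 * (f u - f x)) - (c' - c) * (c' + c) * f u by ring.
apply: le_trans (ler_normB _ _) _; rewrite normrN.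
rewrite [leRHS]mulrDl; apply: lerD; rewrite !normrM.
  have -> : M ^+ 3 * `|u - x| = M ^+ 2 * (M * `|u - x|) by ring.
  apply: ler_pM => //.
  by rewrite gtr0_norm// expr2; apply: ler_pM => //; exact: ltW.
have -> : 2 * M ^+ 4 * (M + 1) * `|u - x|
    = M ^+ 3 * `|u - x| * (2 * M) * (M + 1) by ring.
rewrite (ger0_norm (f_ge0 u)) (gtr0_norm (addr_gt0 c'0 c0)).
apply: ler_pM => //; first by rewrite mulr_ge0// ltW// addr_gt0.
by apply: ler_pM => //; [rewrite ltW// addr_gt0|lra].
Qed.

Lemma gradient_step_bound M x y z : 1 <= M -> local_bounds f g h1 h2 M x ->
  cvx_subdiff g x y -> cvx_subdiff h2 x z ->
  `|gradient_step f g h1 x y z| <= 2 * M + M ^+ 4.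
Proof.
move=> M1 xM gy hz; have [gx0 gxM] := local_bounds_center M1 xM.
have M0 : 0 < M by apply: lt_le_trans M1.
have yM := bound_subdiff_g xM gy; have zM := bound_subdiff_h2 xM hz.
have gM := bound_grad xM; have fM := bound_f xM.
rewrite /gradient_step; apply: le_trans (ler_normB _ _) _.
apply: lerD; first by apply: le_trans (ler_normB _ _) _; lra.
rewrite normrZ normrM (ger0_norm (f_ge0 x)) div1r ger0_norm ?sqr_ge0//.
have -> : M ^+ 4 = M ^+ 2 * M * M by ring.
apply: ler_pM => //; first by rewrite mulr_ge0// sqr_ge0.
apply: ler_pM => //; first exact: sqr_ge0.
by apply: lerXn2r => //; rewrite nnegrE ?invr_ge0 ltW.
Qed.

(** Comparing the trial point with [x] makes |u - x|^2 / (2a) available to absorb errors. It must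
    exceed [B1], which keeps [u] near [x], and [B2], which sums the cost of moving f/g^2 from [x] to
    [u], the remainder of [h1], and the required decrease [sigma / 2]. *)
Lemma line_search_accepts M (sigma : R) : 1 <= M -> 0 < sigma ->
  exists a0 : R, 0 < a0 /\ forall x y z a u,
    local_bounds f g h1 h2 M x -> C x ->
    cvx_subdiff g x y -> cvx_subdiff h2 x z -> 0 < a -> a <= a0 ->
    ampda_trial f g h1 C x y z a u ->
    ampda_accept f g h h1 h2 C sigma x y z u.
Proof.
move=> M1 sigma0; have M0 : 0 < M by apply: lt_le_trans M1.
pose N : R := n%:R; have N0 : 0 <= N by rewrite /N.
pose V := 2 * M + M ^+ 4.
pose Kf := M ^+ 3 + 2 * M ^+ 4 * (M + 1).
have V0 : 0 < V by rewrite addr_gt0 ?mulr_gt0// exprn_gt0.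
have Kf0 : 0 < Kf by rewrite addr_gt0 ?mulr_gt0 ?exprn_gt0// addr_gt0.
pose B1 := M * (M ^+ 3 + N * V).
pose B2 := Kf * N * M + M + sigma / 2.
pose B := Num.max 1 (Num.max B1 B2).
have [B_ge1 B_B1 B_B2] : [/\ 1 <= B, B1 <= B & B2 <= B].
  by rewrite /B !le_max !lexx ?orbT.
have B0 : 0 < B by apply: lt_le_trans B_ge1.
exists (2 * B)^-1; split; first by rewrite invr_gt0 mulr_gt0.
move=> x y z a u xM Cx gy hz a0 aB trial.
have [gx0 gxM] := local_bounds_center M1 xM.
have Ba : B <= (2 * a)^-1.
  rewrite -[B]invrK lef_pV2 ?posrE ?invr_gt0 ?mulr_gt0//.
  have -> : B^-1 = 2 * (2 * B)^-1 by rewrite invfM; field; lra.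
  by rewrite ler_wpM2l.
have [Cu umin] := trial_min a0 gx0 Cx trial.
have := umin _ Cx; rewrite subrr dot0r norm2_0 expr0n /= mulr0 !addr0.
move=> prox_ineq.
have v_bd := gradient_step_bound M1 xM gy hz.
have dD : `|u - x| ^+ 2 <= norm2 (u - x) ^+ 2.
  by rewrite lerXn2r ?nnegrE ?norm2_ge0// norm_le_norm2.
have cx0 : 0 < 1 / g x by rewrite divr_gt0.
have BD : B * `|u - x| ^+ 2 <= (2 * a)^-1 * norm2 (u - x) ^+ 2.
  by apply: ler_pM => //; exact: ltW.
(* The estimates of [bounds_around] only hold within [M^-1], so distant trial points are excluded
   first. Dropping [f u >= 0] leaves a linear bound on the quadratic term; beyond [M^-1] the
   constant [f x / g x] also counts as linear. *)
have ux : `|u - x| <= M^-1.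
  rewrite leNgt; apply/negP => Mux.
  have Md : 1 < M * `|u - x| by rewrite -ltr_pdivrMl// mulr1.
  have d0 : 0 < `|u - x| by apply: lt_trans Mux; rewrite invr_gt0.
  have cf : 1 / g x * f x <= M ^+ 3 * `|u - x|.
    apply: (@le_trans _ _ (M * M)).
      by apply: ler_pM; rewrite ?(ltW cx0)// ?(bound_f xM)// div1r.
    have -> : M ^+ 3 * `|u - x| = M * M * (M * `|u - x|) by ring.
    by rewrite ler_peMr ?ltW// mulr_gt0.
  have vd : - (N * V * `|u - x|) <= dot (gradient_step f g h1 x y z) (u - x).
    have := dot_le (gradient_step f g h1 x y z) (u - x).
    rewrite ler_norml => /andP[+ _]; apply: le_trans.
    by rewrite lerN2 ler_wpM2r// ler_wpM2l.
  have cfu : 0 <= 1 / g x * f u by rewrite mulr_ge0// ltW.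
  have : B * `|u - x| <= M ^+ 3 + N * V.
    by rewrite -(ler_pM2r d0) -mulrA -expr2 mulrDl; lra.
  apply/negP; rewrite -ltNge.
  apply: (@le_lt_trans _ _ (M^-1 * B)).
    by rewrite ler_pdivlMl.
  by rewrite mulrC ltr_pM2l.
have [gu0 guM _ _ _ _ h1u] := bound_around xM ux.
split; first by rewrite /Omega /= gt_eqF.
rewrite (Qfun_subgradient f h1 _ gy hz Cu) -EFinD /objective mem_set; last first.
  by split => //; rewrite /Omega /= gt_eqF.
rewrite lee_fin hE /Qval.
have p_bd : `|dot y (u - x)| <= N * M * `|u - x|.
  apply: le_trans (dot_le _ _) _; rewrite ler_wpM2r// ler_wpM2l//.
  exact: bound_subdiff_g xM _ gy.
have Kp : (1 / g x) ^+ 2 * f x * dot y (u - x)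
    - (1 / g u) ^+ 2 * f u * dot y (u - x) <= Kf * N * M * `|u - x| ^+ 2.
  rewrite -mulrBl; apply: le_trans (ler_norm _) _; rewrite normrM !div1r.
  have -> : Kf * N * M * `|u - x| ^+ 2 = (Kf * `|u - x|) * (N * M * `|u - x|).
    by ring.
  by apply: ler_pM => //; exact: f_div_sqr_bound.
have B2d : (Kf * N * M + M) * `|u - x| ^+ 2 + sigma / 2 * norm2 (u - x) ^+ 2
    <= (2 * a)^-1 * norm2 (u - x) ^+ 2.
  apply: (@le_trans _ _ (B2 * norm2 (u - x) ^+ 2)).
    have c0 : 0 <= Kf * N * M + M.
      by rewrite addr_ge0 ?mulr_ge0// ltW.
    have -> : B2 * norm2 (u - x) ^+ 2 = (Kf * N * M + M) * norm2 (u - x) ^+ 2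
      + sigma / 2 * norm2 (u - x) ^+ 2 by rewrite /B2; ring.
    by rewrite lerD2r ler_wpM2l.
  by rewrite ler_wpM2r ?sqr_ge0// (le_trans B_B2).
have cc : 2 * (1 / g u) * f u - (1 / g u) ^+ 2 * f u * g x <= 1 / g x * f u.
  rewrite -subr_ge0.
  have -> : 1 / g x * f u - (2 * (1 / g u) * f u - (1 / g u) ^+ 2 * f u * g x)
      = f u * (1 / g x) * (1 - g x / g u) ^+ 2 by field; lra.
  by rewrite mulr_ge0 ?sqr_ge0// mulr_ge0// ltW.
move: prox_ineq; rewrite /gradient_step !dotBl dotZl => prox_ineq.
have [_ h1u'] := andP (etrans (esym (ler_norml _ _)) h1u).
have -> : f x / g x = 1 / g x * f x by rewrite mulrC div1r.
by lra.
Qed.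

End LineSearch.

(** * Subgradients of Q *)

Section FrechetIntro.
Context {R : realType} {n : nat}.
Implicit Types (x xi : 'rV[R]_n).

(** The only source of Frechet subgradients in the proof: a quadratic error is negligible before the
    distance, and the minorant is also meaningful where [phi] is infinite. *)
Lemma frechet_subdiff_quadratic (phi : 'rV[R]_n -> \bar R) x xi (r K : R) :
  phi x \is a fin_num -> 0 < r -> 0 <= K ->
  (forall x', `|x' - x| < r ->
    (phi x + (dot xi (x' - x) - K * `|x' - x| ^+ 2)%:E <= phi x')%E) ->
  frechet_subdiff phi x xi.
Proof.
move=> phix r0 K0 phi_ge; split; first by rewrite /dom /= ltey_eq phix.
rewrite limf_einfE; apply/lee_addgt0Pr => e e0.
rewrite -leeBlDr// add0e.
pose rho := Num.min r (e / (K + 1)).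
have rho0 : 0 < rho by rewrite lt_min r0 divr_gt0// ltr_wpDl.
pose V := [set x' | `|x' - x| < rho /\ x' != x].
have V_nbhs : x^' V.
  by rewrite /dnbhs /within /=; apply/nbhs_dist; exists rho.
apply: le_trans (ereal_sup_ubound _); last by exists V.
apply: le_ereal_inf_tmp => _ [x' [xx' x'x] <-].
have {}/phi_ge : `|x' - x| < r by apply: lt_le_trans xx' _; rewrite ge_min lexx.
have /norm2_gt0 nx0 : x' - x != 0 by rewrite subr_eq0.
rewrite -(fineK phix); case: (phi x') => [s| |]; last by [].
  rewrite -EFinD -!EFinB -EFinM !lee_fin => sK.
  rewrite ler_pdivlMr// mulNr.
  have : K * `|x' - x| ^+ 2 <= e * norm2 (x' - x).
    have xe : (K + 1) * `|x' - x| <= e.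
      rewrite mulrC -ler_pdivlMr ?ltr_wpDl//.
      by apply: le_trans (ltW xx') _; rewrite ge_min lexx orbT.
    rewrite expr2 mulrA; apply: ler_pM => //; first by rewrite mulr_ge0.
      by have := normr_ge0 (x' - x); lra.
    exact: norm_le_norm2.
  by lra.
move=> _.
rewrite -[X in (_ <= X * _)%E]/(+oo%E).
by rewrite gt0_mulye ?leey// lte_fin invr_gt0.
Qed.

End FrechetIntro.

(** * Coordinates on the product space *)

Section RowBlocks.
Context {R : realType} {m n : nat}.

Lemma dot_row_mx (a a' : 'rV[R]_m) (b b' : 'rV[R]_n) :
  dot (row_mx a b) (row_mx a' b') = dot a a' + dot b b'.
Proof.
rewrite /dot big_split_ord /=; congr (_ + _); apply: eq_bigr => i _.
  by rewrite !row_mxEl.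
by rewrite !row_mxEr.
Qed.

Lemma norm2_row_mx (a : 'rV[R]_m) (b : 'rV[R]_n) :
  norm2 (row_mx a b) <= norm2 a + norm2 b.
Proof.
rewrite -(@ler_pXn2r _ 2)// ?nnegrE ?addr_ge0 ?norm2_ge0//.
rewrite sqr_norm2 dot_row_mx -!sqr_norm2.
by have := norm2_ge0 a; have := norm2_ge0 b; nra.
Qed.

Lemma norm_row_mx (a : 'rV[R]_m) (b : 'rV[R]_n) (r : R) :
  `|a| <= r -> `|b| <= r -> `|row_mx a b| <= r.
Proof.
move=> ar br; apply: norm_le_coord => [|i]; first exact: le_trans ar.
rewrite mxE; case: splitP => j _; exact: le_trans (coord_le_norm _ _) _.
Qed.

Lemma norm_lsubmx (w : 'rV[R]_(m + n)) : `|lsubmx w| <= `|w|.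
Proof. by apply: norm_le_coord => // i; rewrite mxE coord_le_norm. Qed.

Lemma norm_rsubmx (w : 'rV[R]_(m + n)) : `|rsubmx w| <= `|w|.
Proof. by apply: norm_le_coord => // i; rewrite mxE coord_le_norm. Qed.

End RowBlocks.

Section Quadruple.
Context {R : realType} {n : nat}.
Implicit Types (x y z : 'rV[R]_n) (c : R).

(* The identification of R^n * R^n * R^n * R with R^(n + (n + (n + 1))) of [Qvec]. *)
Definition quad x y z c : 'rV[R]_(n + (n + (n + 1))) :=
  row_mx x (row_mx y (row_mx z (const_mx c))).

Lemma quad_surj (w : 'rV[R]_(n + (n + (n + 1)))) :
  exists x y z c, w = quad x y z c.
Proof.
exists (lsubmx w), (lsubmx (rsubmx w)), (lsubmx (rsubmx (rsubmx w))).
exists (rsubmx (rsubmx (rsubmx w)) 0 0); rewrite /quad.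
have -> : const_mx (rsubmx (rsubmx (rsubmx w)) 0 0) = rsubmx (rsubmx (rsubmx w)).
  by apply/rowP => i; rewrite mxE ord1.
by rewrite !hsubmxK.
Qed.

Lemma quadB x y z c x' y' z' c' :
  quad x y z c - quad x' y' z' c' = quad (x - x') (y - y') (z - z') (c - c').
Proof.
rewrite /quad !opp_row_mx !add_row_mx; congr (row_mx _ (row_mx _ (row_mx _ _))).
by apply/rowP => i; rewrite !mxE.
Qed.

Lemma dot_quad x y z c x' y' z' c' :
  dot (quad x y z c) (quad x' y' z' c') =
    dot x x' + dot y y' + dot z z' + c * c'.
Proof.
by rewrite !dot_row_mx {4}/dot big_ord1 !mxE !addrA.
Qed.

Lemma norm_quad_ge x y z c :
  [/\ `|x| <= `|quad x y z c|, `|y| <= `|quad x y z c|,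
      `|z| <= `|quad x y z c| & `|c| <= `|quad x y z c|].
Proof.
set w := quad x y z c.
have wx : `|x| <= `|w| by have := norm_lsubmx w; rewrite row_mxKl.
have w1 := norm_rsubmx w; rewrite row_mxKr in w1.
have wy : `|y| <= `|w|.
  have := norm_lsubmx (rsubmx w).
  by rewrite /w row_mxKr row_mxKl => /le_trans; apply.
have w2 := norm_rsubmx (rsubmx w); rewrite {1 2}/w !row_mxKr in w2.
have wz := norm_lsubmx (rsubmx (rsubmx w)); rewrite /w !row_mxKr row_mxKl in wz.
have w3 := norm_rsubmx (rsubmx (rsubmx w)); rewrite /w !row_mxKr in w3.
split => //.
  exact: le_trans wz (le_trans w2 w1).
apply: le_trans (le_trans w3 (le_trans w2 w1)).
by have := coord_le_norm (const_mx c : 'rV[R]_1) 0; rewrite mxE.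
Qed.

Lemma norm_quad_le x y z c (r : R) : `|x| <= r -> `|y| <= r -> `|z| <= r ->
  `|c| <= r -> `|quad x y z c| <= r.
Proof.
move=> xr yr zr cr; do 3 apply: norm_row_mx => //.
by apply: norm_le_coord => [|i]; rewrite ?mxE// (le_trans _ xr).
Qed.

Lemma norm2_quad x y z c :
  norm2 (quad x y z c) <= n%:R * (`|x| + `|y| + `|z|) + `|c|.
Proof.
apply: le_trans (norm2_row_mx _ _) _.
have := norm2_row_mx y (row_mx z (const_mx c : 'rV[R]_1)).
have := norm2_row_mx z (const_mx c : 'rV[R]_1).
have -> : norm2 (const_mx c : 'rV[R]_1) = `|c|.
  by rewrite /norm2 /dot big_ord1 !mxE -expr2 sqrtr_sqr.
have := norm2_le x; have := norm2_le y; have := norm2_le z.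
rewrite !mulrDr; lra.
Qed.

Lemma Qvec_quad (f g h1 h2 : 'rV[R]_n -> R) C x y z c :
  Qvec f g h1 h2 C (quad x y z c) = Qfun f g h1 h2 C x y z c.
Proof. by rewrite /Qvec !row_mxKr !row_mxKl mxE. Qed.

End Quadruple.

Section FrechetQ.
Context {R : realType} {n : nat}.
Variables f g h1 h2 : 'rV[R]_n -> R.
Variable C : set 'rV[R]_n.
Hypothesis f_ge0 : forall x, 0 <= f x.
Implicit Types (u v x y z xi : 'rV[R]_n) (c : R).

(** Both conjugates are replaced by their Fenchel-Young lower bounds at the fixed point [x], which
    reduces minorizing Q to a real inequality; [f u >= 0] allows the bound on the conjugate of [g]
    to be multiplied by its coefficient. *)
Lemma Qfun_ge x u y z c (r : R) :
  (C u -> r <= 2 * c * f u + c ^+ 2 * f u * (dot x y - g x - dot u y) + h1 u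
              + (dot x z - h2 x) - dot u z) ->
  (r%:E <= Qfun f g h1 h2 C u y z c)%E.
Proof.
move=> r_le; rewrite /Qfun; case: ifP => [/andP[gy hz]|_]; last exact: leey.
have := conj_fun_ge h2 x z; move: hz; case: (conj_fun h2 z) => // b _.
have := conj_fun_ge g x y; move: gy; case: (conj_fun g y) => // a _.
rewrite !lee_fin => ga hb; rewrite /indic_ext.
have [/set_mem Cu|_] := boolP (u \in C); last first.
  by rewrite -!(EFinB, EFinM) !addye// leey.
rewrite add0e -!(EFinB, EFinM, EFinD) lee_fin.
apply: le_trans (r_le Cu) _.
have cf0 : 0 <= c ^+ 2 * f u by rewrite mulr_ge0// sqr_ge0.
by have := ler_wpM2l cf0 ga; lra.
Qed.

(** What remains of (2(c+t) + (c+t)^2 (E-p-q)) - (2c + c^2 E) after its linear part (2+2cE)t - c^2 p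
    is removed. Here [p] has order [r] and [q] order [r ^+ 2]; [r <= 1] absorbs the higher
    powers. *)
Lemma perturbation_bound (c E p q t r P N : R) : 0 <= r <= 1 -> 0 <= P -> 0 <= N ->
  `|p| <= P * r -> `|q| <= N * r ^+ 2 -> `|t| <= r ->
  `|2 * c * t * (- p - q) + t ^+ 2 * (E - p - q) - c ^+ 2 * q| <=
    (2 * `|c| * (P + N) + (`|E| + P + N) + c ^+ 2 * N) * r ^+ 2.
Proof.
move=> /andP[r0 r1] P0 N0 pP qN tr.
have r2 : r ^+ 2 <= r by rewrite expr2 ler_piMr.
have pq : `|- p - q| <= (P + N) * r.
  apply: le_trans (ler_normB _ _) _; rewrite normrN mulrDl lerD//.
  by apply: le_trans qN _; rewrite ler_wpM2l.
apply: le_trans (ler_normB _ _) _; rewrite [leRHS]mulrDl; apply: lerD; last first.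
  by rewrite normrM ger0_norm ?sqr_ge0// -[leRHS]mulrA ler_wpM2l// sqr_ge0.
apply: le_trans (ler_normD _ _) _; rewrite [leRHS]mulrDl; apply: lerD.
  have -> : 2 * `|c| * (P + N) * r ^+ 2 = 2 * `|c| * r * ((P + N) * r) by ring.
  rewrite !normrM normr_nat; apply: ler_pM => //.
  by rewrite ler_wpM2l// mulr_ge0.
rewrite normrM normrX [leRHS]mulrC; apply: ler_pM => //.
  by rewrite lerXn2r ?nnegrE.
rewrite -addrA -addrA; apply: le_trans (ler_normD _ _) _; rewrite lerD2l.
by apply: le_trans pq _; rewrite ler_piMr// addr_ge0.
Qed.

(** [b] is the coefficient of [f u] in Q, and the four blocks are the formal partial derivatives,
    with [x] standing for a subgradient of both conjugates. The sign of [b] matters because it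
    multiplies the minorant of [f] on [C]. *)
Lemma frechet_subdiff_Qvec x y z u xi c (L rho kappa : R) :
  let d := u - x in
  let E := - (g x + dot y d) in
  let b := 2 * c + c ^+ 2 * E in
  cvx_subdiff g x y -> cvx_subdiff h2 x z -> C u -> 0 <= b ->
  0 < rho -> 0 <= L -> 0 <= kappa ->
  (forall u', `|u' - u| < rho -> `|f u' - f u| <= L * `|u' - u|) ->
  (forall u', `|u' - u| < rho ->
     `|h1 u' - h1 u - dot (grad h1 u) (u' - u)| <= L * `|u' - u| ^+ 2) ->
  (forall w, C w -> f u + dot xi (w - u) - kappa * `|w - u| ^+ 2 <= f w) ->
  frechet_subdiff (Qvec f g h1 h2 C) (quad u y z c)
    (quad (b *: xi - (c ^+ 2 * f u) *: y + grad h1 u - z)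
          (- (c ^+ 2 * f u) *: d) (- d) (f u * (2 + 2 * c * E))).
Proof.
move=> d E b gy hz Cu b0 rho0 L0 kappa0 fL h1L f_ge.
pose N : R := n%:R; have N0 : 0 <= N by rewrite /N.
pose P := N * (`|d| + `|y|); have P0 : 0 <= P by rewrite mulr_ge0// addr_ge0.
pose K1 := 2 * `|c| * (P + N) + (`|E| + P + N) + c ^+ 2 * N.
have K10 : 0 <= K1.
  by do ?[by []|exact: sqr_ge0|apply: addr_ge0|apply: mulr_ge0].
pose K2 := K1 + (`|2 + 2 * c * E| + c ^+ 2 * P).
have K20 : 0 <= K2.
  by do ?[by []|exact: sqr_ge0|apply: addr_ge0|apply: mulr_ge0].
(* One term per second-order error: the minorant of [f], the remainder of its coefficient, the
   product of the two increments, the pairing of [u' - u] with [z' - z], and the expansion of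
   [h1]. *)
pose K := b * kappa + f u * K1 + L * K2 + N + L.
have QE : Qvec f g h1 h2 C (quad u y z c) = (Qval f g h1 h2 x y z u c)%:E.
  by rewrite Qvec_quad (Qfun_subgradient f h1 c gy hz Cu).
apply: (@frechet_subdiff_quadratic _ _ _ _ _ (Num.min rho 1) K).
- by rewrite QE.
- by rewrite lt_min rho0 ltr01.
- by do ?[by []|exact: sqr_ge0|apply: addr_ge0|apply: mulr_ge0].
move=> w'; have [u' [y' [z' [c' ->]]]] := quad_surj w'.
rewrite quadB lt_min => /andP[].
set r := `|quad _ _ _ _| => r_rho r1.
have [uw yw zw cw] : [/\ `|u' - u| <= r, `|y' - y| <= r, `|z' - z| <= r
    & `|c' - c| <= r] := norm_quad_ge _ _ _ _.
have r0 : 0 <= r by exact: normr_ge0.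
have r01 : 0 <= r <= 1 by rewrite r0 ltW.
rewrite QE Qvec_quad dot_quad -EFinD; apply: (Qfun_ge (x := x)) => Cu'.
have dot_bd (a a' : 'rV[R]_n) s : `|a'| <= s -> `|dot a a'| <= N * `|a| * s.
  by move=> ar; apply: le_trans (dot_le _ _) _; rewrite ler_wpM2l// mulr_ge0.
have dot_bd2 (a a' : 'rV[R]_n) : `|a| <= r -> `|a'| <= r ->
    `|dot a a'| <= N * r ^+ 2.
  move=> ar ar'; apply: le_trans (dot_bd _ _ _ ar') _.
  by rewrite -mulrA ler_wpM2l// expr2 ler_wpM2r.
pose p := dot d (y' - y) + dot y (u' - u); pose q := dot (u' - u) (y' - y).
have pP : `|p| <= P * r.
  apply: le_trans (ler_normD _ _) _; rewrite /P mulrDr mulrDl.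
  by rewrite lerD// dot_bd.
have qN : `|q| <= N * r ^+ 2 by exact: dot_bd2.
have pert := perturbation_bound c E r01 P0 N0 pP qN cw.
rewrite -/K1 in pert.
pose lin := (2 + 2 * c * E) * (c' - c) - c ^+ 2 * p.
pose A' := 2 * c' + c' ^+ 2 * (dot x y' - g x - dot u' y').
have EE : dot x y' - g x - dot u' y' = E - p - q.
  by rewrite /E /p /q /d !(dotBl, dotBr) !(dotC y); ring.
have AE : A' - b = lin + (2 * c * (c' - c) * (- p - q)
    + (c' - c) ^+ 2 * (E - p - q) - c ^+ 2 * q).
  by rewrite /A' EE /b /lin; ring.
have lin_bd : `|lin| <= (`|2 + 2 * c * E| + c ^+ 2 * P) * r.
  apply: le_trans (ler_normB _ _) _; rewrite [leRHS]mulrDl; apply: lerD; rewrite normrM.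
    by rewrite ler_wpM2l.
  by rewrite ger0_norm ?sqr_ge0// -[leRHS]mulrA ler_wpM2l// sqr_ge0.
have Ab : `|A' - b| <= K2 * r.
  rewrite AE addrC; apply: le_trans (ler_normD _ _) _.
  rewrite /K2 [leRHS]mulrDl; apply: lerD => //.
  by apply: le_trans pert _; rewrite ler_wpM2l// expr2 ler_piMr// ltW.
have u'rho : `|u' - u| < rho by apply: le_lt_trans r_rho.
have cross : - (L * K2 * r ^+ 2) <= (f u' - f u) * (A' - b).
  have : `|(f u' - f u) * (A' - b)| <= L * K2 * r ^+ 2.
    have -> : L * K2 * r ^+ 2 = (L * r) * (K2 * r) by ring.
    rewrite normrM; apply: ler_pM => //.
    by apply: le_trans (fL _ u'rho) _; rewrite ler_wpM2l.
  by rewrite ler_norml => /andP[].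
have sq_r : `|u' - u| ^+ 2 <= r ^+ 2 by rewrite lerXn2r ?nnegrE.
have h1u' : h1 u + dot (grad h1 u) (u' - u) - L * r ^+ 2 <= h1 u'.
  have := h1L _ u'rho; rewrite ler_norml => /andP[+ _].
  by have := ler_wpM2l L0 sq_r; lra.
have f_main : b * (dot xi (u' - u) - kappa * r ^+ 2) <= b * (f u' - f u).
  rewrite ler_wpM2l//; have := f_ge _ Cu'.
  by have := ler_wpM2l kappa0 sq_r; lra.
have f_lin : - (f u * K1 * r ^+ 2) <= f u * (A' - b - lin).
  rewrite AE addrC addKr -mulrA -mulrN ler_wpM2l//.
  by move: pert; rewrite ler_norml => /andP[].
have qz : `|dot (u' - u) (z' - z)| <= N * r ^+ 2 by exact: dot_bd2.
have {}qz := andP (etrans (esym (ler_norml _ _)) qz).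
have zE : dot x z' - dot u' z' = dot x z - dot u z - dot d (z' - z)
    - dot z (u' - u) - dot (u' - u) (z' - z).
  by rewrite /d !(dotBl, dotBr) !(dotC z); ring.
(* A discrete product rule: only [b * (f u' - f u)] uses the subgradient [xi]; the last product is
   quadratic since [f] is Lipschitz near [u]. *)
have fA : A' * f u' = b * f u + b * (f u' - f u) + f u * lin
    + f u * (A' - b - lin) + (f u' - f u) * (A' - b) by ring.
have -> : 2 * c' * f u' + c' ^+ 2 * f u' * (dot x y' - g x - dot u' y')
    = A' * f u' by rewrite /A'; ring.
have -> : Qval f g h1 h2 x y z u c = b * f u + h1 u - h2 x - dot z d.
  by rewrite /Qval /b /E /d; ring.
have -> : dot (b *: xi - (c ^+ 2 * f u) *: y + grad h1 u - z) (u' - u)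
    + dot (- (c ^+ 2 * f u) *: d) (y' - y) + dot (- d) (z' - z)
    + f u * (2 + 2 * c * E) * (c' - c)
    = b * dot xi (u' - u) + dot (grad h1 u) (u' - u) - dot z (u' - u)
      - dot d (z' - z) + f u * lin.
  have dotE (a s : R) v1 v2 v3 v4 d' t1 t2 t3 :
      dot (a *: v1 - s *: v2 + v3 - v4) t1 + dot (- s *: d') t2 + dot (- d') t3
      = a * dot v1 t1 - s * dot v2 t1 + dot v3 t1 - dot v4 t1
        - s * dot d' t2 - dot d' t3.
    by rewrite !(dotDl, dotNl, dotZl); ring.
  by rewrite dotE /lin /p; ring.
move: fA cross h1u' f_main f_lin qz zE => -> cross h1u' f_main f_lin [_ qz] zE.
rewrite -/(A' - b) /K.
have zd : dot z d = dot u z - dot x z by rewrite /d dotBr !(dotC z).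
by rewrite zd; lra.
Qed.

End FrechetQ.

Section TrialSubgradient.
Context {R : realType} {n : nat}.
Variables f g h1 h2 : 'rV[R]_n -> R.
Variable C : set 'rV[R]_n.
Hypothesis f_ge0 : forall x, 0 <= f x.
Implicit Types (u v w x y z : 'rV[R]_n) (M : R).

(** Expanding the squared distance to [x] around [u] turns minimality into a minorant of [f] on [C]
    that touches at [u]; multiplying by [g x] clears the factor [1 / g x]. *)
Lemma trial_lower_bound x y z a u w : 0 < a -> 0 < g x -> C x ->
  ampda_trial f g h1 C x y z a u -> C w ->
  f u + dot (- g x *: (gradient_step f g h1 x y z + a^-1 *: (u - x))) (w - u)
    - g x * (2 * a)^-1 * n%:R ^+ 2 * `|w - u| ^+ 2 <= f w.
Proof.
move=> a0 gx0 Cx trial Cw; have [Cu] := trial_min a0 gx0 Cx trial.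
move=> /(_ _ Cw); move: (gradient_step f g h1 x y z) => v.
have -> : norm2 (w - x) ^+ 2 = norm2 (w - u) ^+ 2 + 2 * dot (u - x) (w - u)
    + norm2 (u - x) ^+ 2.
  have -> : w - x = (w - u) + (u - x) by rewrite addrA subrK.
  rewrite !sqr_norm2; move: (w - u) (u - x) => s t.
  by rewrite !(dotDl, dotDr) (dotC t s); ring.
have -> : dot v (w - x) = dot v (w - u) + dot v (u - x).
  by rewrite -dotDr addrA subrK.
have -> : dot (- g x *: (v + a^-1 *: (u - x))) (w - u)
    = - g x * (dot v (w - u) + a^-1 * dot (u - x) (w - u)).
  by rewrite dotZl dotDl dotZl.
have nw : norm2 (w - u) ^+ 2 <= n%:R ^+ 2 * `|w - u| ^+ 2.
  by rewrite -exprMn lerXn2r ?nnegrE ?norm2_ge0 ?mulr_ge0// norm2_le.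
have k0 : 0 < (2 * a)^-1 by rewrite invr_gt0 mulr_gt0.
have {}nw := ler_wpM2l (ltW k0) nw.
have aV : a^-1 = 2 * (2 * a)^-1 by field; lra.
have gV t : g x * (1 / g x * t) = t by field; lra.
rewrite aV => umin; have := ler_wpM2l (ltW gx0) umin.
have := ler_wpM2l (ltW gx0) nw; have := gV (f u); have := gV (f w).
by lra.
Qed.

(** Each block of the subgradient given by [frechet_subdiff_Qvec] vanishes when [u = x]. The radius
    [T^-1] makes the relative errors [e] and [s] sum to at most 1, which gives [0 <= b], and it lies
    below [M^-1]. *)
Lemma trial_subgradient_bound M amin : 1 <= M -> 0 < amin ->
  exists K r : R, [/\ 0 <= K, 0 < r & forall x y z a u,
    local_bounds f g h1 h2 M x -> local_bounds f g h1 h2 M u -> C x ->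
    cvx_subdiff g x y -> cvx_subdiff h2 x z -> amin <= a ->
    ampda_trial f g h1 C x y z a u -> `|u - x| <= r ->
    exists xi, frechet_subdiff (Qvec f g h1 h2 C) (quad u y z (1 / g u)) xi /\
      norm2 xi <= K * `|u - x|].
Proof.
move=> M1 amin0; have M0 : 0 < M by apply: lt_le_trans M1.
pose N : R := n%:R; have N0 : 0 <= N by rewrite /N.
pose V := 2 * M + M ^+ 4.
pose Kf := M ^+ 3 + 2 * M ^+ 4 * (M + 1).
pose T := M ^+ 2 * (1 + N).
have T0 : 0 < T by rewrite mulr_gt0 ?exprn_gt0// ltr_pwDl.
have TM : M <= T.
  have MN : 1 <= M * (1 + N) by nra.
  by have := ler_wpM2l (ltW M0) MN; rewrite /T; lra.
pose Ku := T * V + 2 * amin^-1 + Kf * M + M.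
pose K := N * (Ku + M ^+ 3 + 1) + 2 * M * T.
exists K, T^-1; split; [|by rewrite invr_gt0|].
  have a0 := amin0; rewrite -invr_gt0 in a0.
  by do ?[by []|exact: sqr_ge0|exact: ltW|exact: exprn_ge0|apply: addr_ge0
         |apply: mulr_ge0].
move=> x y z a u xM uM Cx gy hz amin_a trial uxT.
have a0 : 0 < a by apply: lt_le_trans amin_a.
have [gx0 gxM] := local_bounds_center M1 xM.
have [Cu _] := trial_min a0 gx0 Cx trial.
have Td : T * `|u - x| <= 1 by rewrite -ler_pdivlMl ?mulr1.
have ux : `|u - x| <= M^-1.
  by apply: le_trans uxT _; rewrite lef_pV2 ?posrE.
have [gu0 guM _ gux _ gradux _] := bound_around xM ux.
set v := gradient_step f g h1 x y z.
set d := u - x; set p := dot y d.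
set c := 1 / g u.
have c0 : 0 < c by rewrite divr_gt0.
have cM : c <= M by rewrite /c div1r.
pose E := - (g x + p).
pose b := 2 * c + c ^+ 2 * E.
pose e := c * (g u - g x); pose s := c * p.
have e_bd : `|e| <= M ^+ 2 * `|d|.
  rewrite normrM gtr0_norm//.
  have -> : M ^+ 2 * `|d| = M * (M * `|d|) by ring.
  by apply: ler_pM => //; exact: ltW.
have s_bd : `|s| <= M ^+ 2 * N * `|d|.
  rewrite normrM gtr0_norm//.
  have -> : M ^+ 2 * N * `|d| = M * (N * M * `|d|) by ring.
  apply: ler_pM => //; first exact: ltW.
  apply: le_trans (dot_le _ _) _; rewrite ler_wpM2r// ler_wpM2l//.
  exact: bound_subdiff_g xM _ gy.
have es_bd : `|e| + `|s| <= T * `|d|.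
  have -> : T * `|d| = M ^+ 2 * `|d| + M ^+ 2 * N * `|d| by rewrite /T; ring.
  exact: lerD.
have bE : b = c * (1 + e - s) by rewrite /b /E /e /s /c; field; lra.
have b_ge0 : 0 <= b.
  rewrite bE mulr_ge0 ?(ltW c0)//.
  have := ler_norm (- e); have := ler_norm s; rewrite normrN.
  by move: es_bd Td; rewrite -/d; lra.
have bgE : b * g x = (1 - e) * (1 + e - s).
  by rewrite bE /e /c; field; lra.
have bg1 : `|b * g x - 1| <= T * `|d|.
  have -> : b * g x - 1 = - s - e * (e - s) by rewrite bgE; ring.
  apply: le_trans (ler_normB _ _) _; rewrite normrN (normrM e).
  apply: (le_trans _ es_bd); rewrite [leRHS]addrC; apply: lerD => //; rewrite ler_piMr//.
  by apply: le_trans (ler_normB _ _) (le_trans es_bd Td).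
have bg2 : `|b * g x| <= 2.
  have := ler_normD (b * g x - 1) 1; rewrite subrK normr1.
  by move: bg1 Td; rewrite -/d; lra.
pose kappa := g x * (2 * a)^-1 * N ^+ 2.
have kappa0 : 0 <= kappa.
  by rewrite mulr_ge0 ?sqr_ge0// mulr_ge0 ?(ltW gx0)// invr_ge0 mulr_ge0// ltW.
have MV0 : 0 < M^-1 by rewrite invr_gt0.
have fu_lip u' : `|u' - u| < M^-1 -> `|f u' - f u| <= M * `|u' - u|.
  by move=> /ltW /(bound_around uM)[].
have h1u_exp u' : `|u' - u| < M^-1 ->
    `|h1 u' - h1 u - dot (grad h1 u) (u' - u)| <= M * `|u' - u| ^+ 2.
  by move=> /ltW /(bound_around uM)[].
have f_ge w (Cw : C w) := trial_lower_bound a0 gx0 Cx trial Cw.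
have := frechet_subdiff_Qvec f_ge0 gy hz Cu b_ge0 MV0 (ltW M0) kappa0 fu_lip
  h1u_exp f_ge.
move=> xi_sub; eexists; split; first exact: xi_sub.
apply: (le_trans (norm2_quad _ _ _ _)).
rewrite -/c -/d -/v.
have d0 : 0 <= `|d| by [].
have fuM : `|f u| <= M by rewrite ger0_norm// (bound_f uM).
have c2f : `|c ^+ 2 * f u| <= M ^+ 3.
  rewrite normrM; have -> : M ^+ 3 = M ^+ 2 * M by ring.
  by apply: ler_pM => //; rewrite normrX lerXn2r ?nnegrE ?(ltW M0)// gtr0_norm.
have xi_u : `|b *: (- g x *: (v + a^-1 *: d)) - (c ^+ 2 * f u) *: y
    + grad h1 u - z| <= Ku * `|d|.
  (* Replacing [b * g x] by 1 in front of [v] cancels [z] and leaves differences between values at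
     [x] and at [u]. *)
  have -> : b *: (- g x *: (v + a^-1 *: d)) - (c ^+ 2 * f u) *: y
      + grad h1 u - z
    = - ((b * g x - 1) *: v) - (b * g x * a^-1) *: d
      + ((g x)^-1 ^+ 2 * f x - (g u)^-1 ^+ 2 * f u) *: y
      + (grad h1 u - grad h1 x).
    by apply/rowP => i; rewrite /v /gradient_step /c !div1r !mxE; ring.
  have -> : Ku * `|d| = T * V * `|d| + 2 * amin^-1 * `|d| + Kf * M * `|d|
      + M * `|d| by rewrite /Ku; ring.
  apply: le_trans (ler_normD _ _) _.
  apply: lerD => //; apply: le_trans (ler_normD _ _) _; apply: lerD.
    apply: le_trans (ler_normB _ _) _; rewrite normrN !normrZ; apply: lerD.
      have -> : T * V * `|d| = T * `|d| * V by ring.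
      apply: ler_pM => //.
      exact: (gradient_step_bound f_ge0 M1 xM gy hz).
    apply: ler_pM => //; rewrite -normrM; apply: ler_pM => //.
    by rewrite gtr0_norm ?invr_gt0// lef_pV2 ?posrE.
  rewrite normrZ.
  have -> : Kf * M * `|d| = Kf * `|d| * M by ring.
  apply: ler_pM => //; last exact: bound_subdiff_g xM _ gy.
  exact: (f_div_sqr_bound f_ge0 M1 xM ux).
have xi_y : `|- (c ^+ 2 * f u) *: d| <= M ^+ 3 * `|d|.
  by rewrite normrZ normrN ler_wpM2r.
have xi_c : `|f u * (2 + 2 * c * E)| <= 2 * M * T * `|d|.
  have -> : f u * (2 + 2 * c * E) = 2 * f u * (e - s).
    by rewrite /E /e /s /c; field; lra.
  have -> : 2 * M * T * `|d| = 2 * M * (T * `|d|) by ring.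
  rewrite !normrM normr_nat -/d; apply: ler_pM => //.
    by rewrite ler_wpM2l.
  exact: le_trans (ler_normB _ _) es_bd.
have -> : K * `|d| = N * (Ku * `|d| + M ^+ 3 * `|d| + `|d|) + 2 * M * T * `|d|.
  by rewrite /K; ring.
by apply: lerD => //; rewrite ler_wpM2l// normrN lerD// lerD.
Qed.

End TrialSubgradient.

(** * Kurdyka-Lojasiewicz inequality and finite length *)

(** Joins completeness with the normed structure, for the use of [normed_cvg] in
    [finite_length_cvg]. *)
HB.instance Definition _ (R : realType) (m n : nat) := Complete.on 'M[R]_(m, n).

Section Sequences.
Context {R : realType}.

Lemma cluster_subsequence (V : normedModType R) (u : nat -> V) (p : V) :
  cluster (u @ \oo) p -> exists phi : nat -> nat,
    (forall k, (k <= phi k)%N) /\ (u \o phi) @ \oo --> p.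
Proof.
move=> up; have ex k : exists m, (k <= m)%N /\ `|p - u m| < k.+1%:R^-1.
  have [] := up [set u m | m in [set m | (k <= m)%N]] [set v | `|p - v| < k.+1%:R^-1].
  - by exists k => // m km; exists m.
  - apply/nbhs_dist; exists k.+1%:R^-1; first by rewrite invr_gt0.
    by move=> v /=; rewrite distrC.
  by move=> v [[m km <-] pm]; exists m.
have [phi phiP] := choice ex.
exists phi; split => [k|]; first by have [] := phiP k.
apply/cvgrPdist_lt => e e0; near=> k.
have [_ pk] := phiP k; apply: lt_trans pk _ => /=.
by near: k; exact: near_infty_natSinv_lt (PosNum e0).
Unshelve. all: end_near. Qed.

Lemma cvgn_geq_comp (T : ptopologicalType) (u : nat -> T) (l : T) (phi : nat -> nat) :
  (forall k, (k <= phi k)%N) -> u @ \oo --> l -> (u \o phi) @ \oo --> l.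
Proof.
move=> phik ul A /ul [N _ NA]; exists N => // k /= Nk.
exact/NA/(leq_trans Nk).
Qed.

Lemma finite_length_cvg n (x : nat -> 'rV[R]_n) (D : nat -> R) (N0 : nat) (B : R) :
  (forall k, `|x k.+1 - x k| <= D k) ->
  (forall m, \sum_(0 <= j < m) D (j + N0)%N <= B) -> cvgn x.
Proof.
move=> xD DB; pose u := [sequence x (k + N0)%N]_k.
have tele_cvg : cvgn (series (telescope u)).
  apply: normed_cvg; apply: nondecreasing_is_cvgn.
    by apply: nondecreasing_series => k *; exact: normr_ge0.
  exists B => _ [m _ <-]; apply: le_trans (DB m).
  by apply: ler_sum => j _; apply: xD.
have u_cvg : cvgn u.
  have -> : u = cst (u 0%N) \+ series (telescope u).
    by apply/funext => m; rewrite /= -eq_sum_telescope.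
  by apply: is_cvgD => //; exact: is_cvg_cst.
by apply/cvg_ex; exists (limn u); rewrite -(cvg_shiftn N0).
Qed.

End Sequences.

Section KurdykaLojasiewicz.
Context {R : realType}.

(* What the argument uses of a desingularizing function: unlike
   [desingularizing], it involves no regularity and is clearly stable by sum. *)
Definition concave_gauge (e : R) (psi dpsi : R -> R) : Prop :=
  [/\ 0 < e, forall t, 0 <= t < e -> 0 <= psi t,
      forall t, 0 < t < e -> 0 < dpsi t &
      forall s t, 0 <= s <= t -> 0 < t < e -> dpsi t * (t - s) <= psi t - psi s].

Lemma concave_gauge_sum e1 psi1 dpsi1 e2 psi2 dpsi2 :
  concave_gauge e1 psi1 dpsi1 -> concave_gauge e2 psi2 dpsi2 ->
  concave_gauge (Num.min e1 e2) (psi1 \+ psi2) (dpsi1 \+ dpsi2).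
Proof.
move=> [e10 psi10 dpsi10 tan1] [e20 psi20 dpsi20 tan2].
split=> [|t|t|s t st]; rewrite lt_min.
- by rewrite e10.
- by move=> /and3P[t0 t1 t2]; rewrite addr_ge0// ?psi10 ?psi20// t0.
- by move=> /and3P[t0 t1 t2]; rewrite addr_gt0// ?dpsi10 ?dpsi20// t0.
move=> /and3P[t0 t1 t2] /=.
have := tan1 s t st; have := tan2 s t st; rewrite t0 t1 t2 => /(_ isT) + /(_ isT).
by lra.
Qed.

(** [psi] may fail to be differentiable at 0 while [s = 0] is allowed, so the tangent inequality
    uses the derivative at [t] alone: a chord flatter than it would contradict concavity at points
    slightly to the left of [t]. *)
Lemma desingularizing_gauge (eps : \bar R) (psi : R -> R) : (0 < eps)%E ->
  desingularizing eps psi -> exists e, (e%:E <= eps)%E /\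
    concave_gauge e psi (derive1 psi).
Proof.
move=> eps0 [_ psi_cvx psi_ge0 psi0 psi_der].
have [e [e0 e_eps]] : exists e : R, 0 < e /\ (e%:E <= eps)%E.
  case: eps eps0 {psi_cvx psi_ge0 psi_der} => [r r0| _|//].
    by exists r; rewrite lexx.
  by exists 1; rewrite ltr01 leey.
have lt_eps t : t < e -> (t%:E < eps)%E.
  by move=> te; apply: lt_le_trans e_eps; rewrite lte_fin.
exists e; split => //; split => //.
- by move=> t /andP[t0 te]; apply: psi_ge0; split => //; apply: lt_eps.
- by move=> t /andP[t0 te]; have [] := psi_der t t0 (lt_eps _ te).
move=> s t /andP[s0 st] /andP[t0 te].
have [psi_t _ _] := psi_der t t0 (lt_eps _ te).
have [->|s_neq] := eqVneq s t; first by rewrite !subrr mulr0.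
have {}st : s < t by rewrite lt_def eq_sym s_neq.
have ts0 : 0 < t - s by rewrite subr_gt0.
rewrite -ler_pdivlMr// leNgt; apply/negP => slope_lt.
have quot_cvg : (fun h => h^-1 *: (psi (h + t) - psi t)) @ 0^' --> derive1 psi t.
  rewrite derive1E; have := psi_t; rewrite /derivable /derive.
  have -> : (fun h => h^-1 *: ((psi \o shift t) h%:A - psi t))
      = (fun h => h^-1 *: (psi (h + t) - psi t)).
    by apply/funext => h /=; rewrite [h%:A]mulr1.
  by [].
have [d /= d0 dP] := cvgr_gt _ quot_cvg _ slope_lt.
pose l := Num.min 1 (d / 2 / (t - s)).
have l0 : 0 < l by rewrite lt_min ltr01 !divr_gt0.
have l1 : l <= 1 by rewrite ge_min lexx.
have ld : l * (t - s) <= d / 2.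
  by rewrite -ler_pdivlMr// /l ge_min lexx orbT.
have h_neq0 : - (l * (t - s)) != 0 by rewrite oppr_eq0 gt_eqF// mulr_gt0.
have := dP (- (l * (t - s))); rewrite /ball /= sub0r opprK gtr0_norm ?mulr_gt0//.
move=> /(_ _ h_neq0); have -> : l * (t - s) < d by lra.
move=> /(_ isT); have lts0 : 0 < l * (t - s) by rewrite mulr_gt0.
have : - psi (- (l * (t - s)) + t) <= l * - psi s + (1 - l) * - psi t.
  have <- : l * s + (1 - l) * t = - (l * (t - s)) + t by ring.
  apply: (psi_cvx (Itv01 (ltW l0) l1) s t); rewrite inE; split=> //.
  - exact: lt_eps (lt_trans st te).
  - exact: ltW.
  - exact: lt_eps.
move: (psi (_ + t)) => psi_l cvx.
have -> : (- (l * (t - s)))^-1 *: (psi_l - psi t) = (psi t - psi_l) / (l * (t - s)).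
  by rewrite invrN scaleNr -[_ *: _]/(_ * _) -mulrN opprB mulrC.
rewrite ltr_pdivlMr// mulrCA divfK ?gt_eqF// => slope.
by clear eps0 e_eps lt_eps; lra.
Qed.

(** The KL inequality at the indices where the sequence visits [U], with the distance to the
    subdifferential already replaced by its bound [K * D k]. *)
Definition KL_along (T : Type) (w : nat -> T) (r D : nat -> R) (K : R)
    (U : set T) : Prop :=
  exists (e : R) (psi dpsi : R -> R) (N : nat), concave_gauge e psi dpsi /\
    forall k, (N <= k)%N -> U (w k) -> 0 < r k < e -> 1 <= dpsi (r k) * (K * D k).

(** Both derivatives are positive below the smaller threshold, so adding one to the other preserves
    a lower bound by 1. *)
Lemma KL_along_setU (T : Type) (w : nat -> T) r D K (U V : set T) :
  0 <= K -> (forall k, 0 <= D k) ->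
  KL_along w r D K U -> KL_along w r D K V -> KL_along w r D K (U `|` V).
Proof.
move=> K0 D0 [e1 [psi1 [dpsi1 [N1 [gauge1 KL1]]]]].
move=> [e2 [psi2 [dpsi2 [N2 [gauge2 KL2]]]]].
exists (Num.min e1 e2), (psi1 \+ psi2), (dpsi1 \+ dpsi2), (maxn N1 N2).
split=> [|k]; first exact: concave_gauge_sum.
rewrite geq_max lt_min => /andP[N1k N2k] UVk /and3P[r0 r1 r2] /=.
have KD : 0 <= K * D k by rewrite mulr_ge0.
have [_ _ /(_ (r k)) dpsi1_gt0 _] := gauge1.
have [_ _ /(_ (r k)) dpsi2_gt0 _] := gauge2.
rewrite r0 r1 in dpsi1_gt0; rewrite r0 r2 in dpsi2_gt0.
have p1 := mulr_ge0 (ltW (dpsi1_gt0 isT)) KD.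
have p2 := mulr_ge0 (ltW (dpsi2_gt0 isT)) KD.
rewrite mulrDl; case: UVk => [/(KL1 _ N1k)|/(KL2 _ N2k)]; rewrite r0 ?r1 ?r2.
  by move=> /(_ isT); lra.
by move=> /(_ isT); lra.
Qed.

Lemma KL_along_subset (T : Type) (w : nat -> T) r D K (U V : set T) :
  U `<=` V -> KL_along w r D K V -> KL_along w r D K U.
Proof.
move=> UV [e [psi [dpsi [N [gauge KL]]]]]; exists e, psi, dpsi, N.
by split => // k Nk /UV; apply: KL.
Qed.

(* The sets whose complement satisfies [KL_along] form a filter; if it were
   proper, it would have a cluster point in the compact set. *)
Lemma KL_along_compact (T : topologicalType) (w : nat -> T) r D K (A : set T) :
  0 <= K -> (forall k, 0 <= D k) -> compact A -> (forall k, A (w k)) ->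
  (forall p, cluster (w @ \oo) p -> exists2 U, nbhs p U & KL_along w r D K U) ->
  KL_along w r D K setT.
Proof.
move=> K0 D0 A_compact Aw KLp; apply: contrapT => notKL.
have gauge1 : concave_gauge 1 (fun t : R => t) (fun=> 1).
  split => //; first by move=> t /andP[].
  by move=> s t _ _; rewrite mul1r.
pose F : set_system T := [set B | KL_along w r D K (~` B)].
have FF : ProperFilter F.
  apply: Build_ProperFilter_ex.
    move=> B FB; apply: contrapT => B0; apply: notKL.
    apply: KL_along_subset FB => p _ Bp; apply: B0; by exists p.
  split.
  - by exists 1, (fun t => t), (fun=> 1), 0%N; split => // k _ /(_ I).
  - by move=> P Q FP FQ; rewrite /F /= setCI; apply: KL_along_setU.
  - move=> P Q PQ; apply: KL_along_subset; exact: subsetC.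
have FA : F A.
  by exists 1, (fun t => t), (fun=> 1), 0%N; split => // k _ /(_ (Aw k)).
have [p [Ap Fp]] := A_compact F FF FA.
have [U pU KLU] : exists2 U, nbhs p U & KL_along w r D K U.
  (* Away from the cluster points, the sequence eventually leaves some neighborhood, where the
     inequality holds vacuously with any gauge. *)
  have [/KLp//|not_cl] := pselect (cluster (w @ \oo) p).
  have [B [U [[N _ NB] [pU BU]]]] : exists B U, (w @ \oo) B /\ nbhs p U /\
      B `&` U = set0.
    apply: contrapT => no; apply: not_cl => B U wB pU.
    by apply/set0P/negP => /eqP BU; apply: no; exists B, U.
  exists U => //; exists 1, (fun t => t), (fun=> 1), N; split => // k Nk Uk.
  by have : set0 (w k) by rewrite -BU; split => //; apply: NB.
have FU : F (~` U) by rewrite /F /= setCK.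
by have [q [nUq Uq]] := Fp _ _ FU pU.
Qed.

(** The potential 2 D_k + 2a psi(r_k) drops by at least D_k at each step, once [r] is below the
    threshold of the gauge. *)
Lemma KL_finite_length (T : Type) (w : nat -> T) (r D : nat -> R) (K s : R) :
  0 < K -> 0 < s -> (forall k, 0 <= D k) -> (forall k, 0 <= r k) ->
  (forall k, r k.+1 + s * D k.+1 ^+ 2 <= r k) -> r @ \oo --> 0 ->
  KL_along w r D K setT ->
  exists N B, forall m, \sum_(0 <= j < m) D (j + N)%N <= B.
Proof.
move=> K0 s0 D0 r_ge0 r_decr r_cvg [e [psi [dpsi [N1 [[e0 psi_ge0 dpsi_gt0 tan] KL]]]]].
have [N2 _ N2P] : \forall k \near \oo, r k < e.
  have /cvgrPdist_lt /(_ e e0) := r_cvg; apply: filterS => k.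
  by rewrite sub0r normrN ger0_norm.
pose N := maxn N1 N2.
have r_lt k : (N <= k)%N -> r k < e.
  by rewrite geq_max => /andP[_]; exact: N2P.
(* Chosen so that the squared step is at most 2a D_k times the drop of [psi]. *)
pose a := K / (2 * s).
have a0 : 0 < a by rewrite divr_gt0// mulr_gt0.
have step k : (N <= k)%N ->
    D k + (2 * D k.+1 + 2 * a * psi (r k.+1)) <= 2 * D k + 2 * a * psi (r k).
  move=> Nk; have rke := r_lt _ Nk; have rk := r_ge0 k; have rk1 := r_ge0 k.+1.
  have decr := r_decr k; have Dk := D0 k; have Dk1 := D0 k.+1.
  have sD : 0 <= s * D k.+1 ^+ 2 by rewrite mulr_ge0 ?sqr_ge0// ltW.
  (* The KL inequality says nothing at [r k = 0]; there the decrease forces [r k.+1] and [D k.+1] to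
     vanish. *)
  have [rk0|rk_neq0] := eqVneq (r k) 0.
    have rk10 : r k.+1 = 0 by lra.
    have : s * D k.+1 ^+ 2 = 0 by lra.
    move=> /eqP; rewrite mulf_eq0 gt_eqF//= sqrf_eq0 => /eqP ->.
    by rewrite rk0 rk10; lra.
  have rk_gt0 : 0 < r k by rewrite lt_def rk_neq0.
  have r_int : 0 < r k < e by rewrite rk_gt0.
  have dp := dpsi_gt0 _ r_int.
  have N1k : (N1 <= k)%N by move: Nk; rewrite geq_max => /andP[].
  have KLk := KL k N1k I r_int.
  have rr : 0 <= r k.+1 <= r k by rewrite rk1; lra.
  have tank := tan _ _ rr r_int.
  set Del := psi (r k) - psi (r k.+1) in tank *.
  have h1 : s * D k.+1 ^+ 2 <= K * D k * Del.
    have KD : 0 <= K * D k by rewrite mulr_ge0// ltW.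
    apply: le_trans (ler_wpM2l KD tank).
    apply: (@le_trans _ _ (s * D k.+1 ^+ 2 * (dpsi (r k) * (K * D k)))).
      by rewrite ler_peMr.
    have -> : K * D k * (dpsi (r k) * (r k - r k.+1)) =
      (r k - r k.+1) * (dpsi (r k) * (K * D k)) by ring.
    rewrite ler_wpM2r//; first by rewrite mulr_ge0// ltW.
    by lra.
  have h2 : D k.+1 ^+ 2 <= 2 * a * D k * Del.
    rewrite -(ler_pM2l s0); apply: le_trans h1 _.
    by rewrite le_eqVlt; apply/orP; left; apply/eqP; rewrite /a; field; lra.
  have Del0 : 0 <= Del.
    by apply: le_trans tank; rewrite mulr_ge0 ?(ltW dp)//; lra.
  (* AM-GM on the two factors [D k] and [2 * a * Del] of [h2] *)
  have : D k.+1 <= D k / 2 + a * Del.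
    have rhs0 : 0 <= D k / 2 + a * Del by rewrite addr_ge0// mulr_ge0// ltW.
    rewrite -(@ler_pXn2r _ 2)// ?nnegrE//; apply: le_trans h2 _.
    by have := sqr_ge0 (D k / 2 - a * Del); lra.
  by rewrite /Del; lra.
pose Phi k := 2 * D k + 2 * a * psi (r k).
exists N, (Phi N) => m.
suff : \sum_(0 <= j < m) D (j + N)%N + Phi (m + N)%N <= Phi N.
  apply: le_trans; rewrite lerDl /Phi addr_ge0// mulr_ge0//.
    by rewrite mulr_ge0// ltW.
  by apply: psi_ge0; rewrite r_ge0 r_lt// leq_addl.
elim: m => [|m IH]; first by rewrite big_geq// add0r add0n.
rewrite big_nat_recr//=; apply: le_trans IH; rewrite -addrA lerD2l.
exact: step (leq_addl _ _).
Qed.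

End KurdykaLojasiewicz.

(** * Passing to the limit along subsequences *)

Section Limits.
Context {R : realType} {n : nat}.
Implicit Types (u v : nat -> 'rV[R]_n) (a b p : 'rV[R]_n).

Lemma dot_cvg u v a b : u @ \oo --> a -> v @ \oo --> b ->
  (fun k => dot (u k) (v k)) @ \oo --> dot a b.
Proof.
move=> ua vb; rewrite /dot; apply: (cvg_big add_continuous) => i _.
have coord (t : nat -> 'rV[R]_n) (c : 'rV[R]_n) : t @ \oo --> c ->
    (fun k => t k 0 i : R) @ \oo --> (c 0 i : R).
  by move=> tc; apply: (cvg_comp _ _ tc (@coord_continuous _ _ _ 0 i c)).
by apply: cvgM; apply: coord.
Qed.

Lemma cvg_lipschitz (V : normedModType R) (F : 'rV[R]_n -> V) p (r L : R) u :
  0 < r -> (forall q, `|q - p| <= r -> `|F q - F p| <= L * `|q - p|) ->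
  u @ \oo --> p -> (F \o u) @ \oo --> F p.
Proof.
move=> r0 FL up; apply/cvgrPdist_lt => e e0.
pose d := Num.min r (e / (`|L| + 1)).
have L1 : 0 < `|L| + 1 by rewrite ltr_wpDl.
have d0 : 0 < d by rewrite lt_min r0 divr_gt0.
move/cvgrPdist_lt: up => /(_ d d0); apply: filterS => k; rewrite distrC => kd /=.
rewrite distrC; apply: (le_lt_trans (FL _ _)).
  by apply: ltW; apply: lt_le_trans kd _; rewrite ge_min lexx.
apply: (@le_lt_trans _ _ (`|L| * `|u k - p|)); first by rewrite ler_wpM2r// ler_norm.
apply: (@le_lt_trans _ _ (`|L| * d)); first by rewrite ler_wpM2l// ltW.
apply: (@lt_le_trans _ _ ((`|L| + 1) * d)); first by rewrite ltr_pM2r// ltrDl.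
by rewrite mulrC -ler_pdivlMr// /d ge_min lexx orbT.
Qed.

Lemma cvx_subdiff_closed (g : 'rV[R]_n -> R) u v a b :
  u @ \oo --> a -> v @ \oo --> b -> (g \o u) @ \oo --> g a ->
  (forall k, cvx_subdiff g (u k) (v k)) -> cvx_subdiff g a b.
Proof.
move=> ua vb gua uv w.
have wu : (fun k => w - u k) @ \oo --> w - a.
  by apply: cvgB => //; exact: cvg_cst.
apply: (cvgr_to_le (cvgD gua (dot_cvg vb wu))).
by apply: nearW => k; apply: uv.
Qed.

Lemma nonincreasing_subseq_cvg (t : nat -> R) (phi : nat -> nat) (l : R) :
  (forall k, t k.+1 <= t k) -> (forall k, (k <= phi k)%N) ->
  (t \o phi) @ \oo --> l -> t @ \oo --> l /\ forall k, l <= t k.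
Proof.
move=> t_decr phik tl.
have t_mono k m : (k <= m)%N -> t m <= t k.
  by elim: m => [|m IH]; [rewrite leqn0 => /eqP ->|
    rewrite leq_eqVlt => /predU1P[->//|/IH]; exact: le_trans].
have l_le k : l <= t k.
  apply: (cvgr_to_le tl); exists k => // m /= km.
  exact/t_mono/(leq_trans km).
split=> //; apply/cvgrPdist_lt => e e0.
move/cvgrPdist_lt: tl => /(_ e e0)[N _ NP].
exists (phi N) => // k /= Nk.
have := NP N (leqnn N); rewrite /= !ler0_norm ?subr_le0//.
by have := t_mono _ _ Nk; lra.
Qed.

Lemma compact_norm_le (B : R) : compact [set w : 'rV[R]_n | `|w| <= B].
Proof.
apply: bounded_closed_compact.
  by exists B; split; [exact: num_real|move=> c Bc w /= /le_trans; apply; exact: ltW].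
have -> : [set w : 'rV[R]_n | `|w| <= B] = Num.norm @^-1` [set c : R | c <= B] by [].
by apply: closed_comp => [w _|]; [exact: norm_continuous|exact: closed_le].
Qed.

Lemma quad_cvg (s t v : nat -> 'rV[R]_n) (c : nat -> R) a b d (e : R) :
  (fun k => quad (s k) (t k) (v k) (c k)) @ \oo --> quad a b d e ->
  [/\ s @ \oo --> a, t @ \oo --> b, v @ \oo --> d & c @ \oo --> e].
Proof.
move/cvgrPdist_lt => w_cvg.
by split; apply/cvgrPdist_lt => r /w_cvg; apply: filterS => k;
  rewrite quadB; apply: le_lt_trans;
  have [] := norm_quad_ge (a - s k) (b - t k) (d - v k) (e - c k).
Qed.

End Limits.

(** * Convergence of the iterates *)

Section Run.
Context {R : realType} {n : nat}.
Variables f g h h1 h2 : 'rV[R]_n -> R.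
Variable C : set 'rV[R]_n.
Variables alo ahi sigma gamma : R.
Variable x0 : 'rV[R]_n.
Variables x y z : nat -> 'rV[R]_n.
Variable alpha : nat -> R.
Hypothesis f_ge0 : forall u, 0 <= f u.
Hypothesis g_ge0 : forall u, 0 <= g u.
Hypothesis hE : forall u, h u = h1 u - h2 u.
Hypothesis alo_gt0 : 0 < alo.
Hypothesis sigma_gt0 : 0 < sigma.
Hypothesis gamma_gt0 : 0 < gamma.
Hypothesis x0_dom : dom (objective f g h C) x0.
Hypothesis run : ampda_run f g h h1 h2 C alo ahi sigma gamma x0 x y z alpha.

Let X : set 'rV[R]_n := [set u | dom (objective f g h C) u /\
  (objective f g h C u <= objective f g h C x0)%E].

Let F u : R := f u / g u + h u.

Lemma objective_E u : Omega g u -> C u -> objective f g h C u = (F u)%:E.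
Proof. by move=> gu Cu; rewrite /objective mem_set. Qed.

Lemma dom_objective u : dom (objective f g h C) u <-> Omega g u /\ C u.
Proof.
split=> [|[gu Cu]]; last by rewrite /dom /= objective_E ?ltry.
by rewrite /dom /= /objective; case: ifPn => [/set_mem[]|]; rewrite ?ltxx.
Qed.

Lemma Omega_gt0 u : Omega g u -> 0 < g u.
Proof. by move=> gu; rewrite lt_def gu g_ge0. Qed.

Lemma run_subgradients k : cvx_subdiff g (x k) (y k) /\ cvx_subdiff h2 (x k) (z k).
Proof. by have [_ /(_ k)[]] := run. Qed.

Lemma run_trial k : 0 < alpha k /\
  ampda_trial f g h1 C (x k) (y k) (z k) (alpha k) (x k.+1).
Proof.
have [_ /(_ k)[_ _ [a0 [j [xhat [/andP[a0l _] tr _ _ [-> ->]]]]]]] := run.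
by split; [rewrite mulr_gt0 ?exprn_gt0// (lt_le_trans alo_gt0)|apply: tr].
Qed.

Lemma run_accept k : ampda_accept f g h h1 h2 C sigma (x k) (y k) (z k) (x k.+1).
Proof. by have [_ /(_ k)[_ _ [? [? [? [_ _ _ + [-> _]]]]]]] := run. Qed.

Lemma run_domain k : Omega g (x k) /\ C (x k).
Proof.
elim: k => [|k [Ok Ck]]; first by have [-> _] := run; apply/dom_objective.
have [Ok1 _] := run_accept k; split => //.
have [ak tr] := run_trial k.
by have [] := trial_min ak (Omega_gt0 Ok) Ck tr.
Qed.

Definition run_Q k : R := Qval f g h1 h2 (x k) (y k) (z k) (x k.+1) (1 / g (x k.+1)).

Definition run_w k := quad (x k.+1) (y k) (z k) (1 / g (x k.+1)).

Definition run_D k : R := norm2 (x k.+1 - x k).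

Lemma Qvec_run k : Qvec f g h1 h2 C (run_w k) = (run_Q k)%:E.
Proof.
have [gy hz] := run_subgradients k; have [_ Ck1] := run_domain k.+1.
by rewrite Qvec_quad (Qfun_subgradient f h1 _ gy hz Ck1).
Qed.

Lemma run_Q_le k : run_Q k + sigma / 2 * run_D k ^+ 2 <= F (x k).
Proof.
have [gy hz] := run_subgradients k; have [_ Ck1] := run_domain k.+1.
have [Ok Ck] := run_domain k; have [_] := run_accept k.
by rewrite (Qfun_subgradient f h1 _ gy hz Ck1) objective_E// -EFinD lee_fin.
Qed.

Lemma Qval_diag u v w : 0 < g u -> Qval f g h1 h2 u v w u (1 / g u) = F u.
Proof. by move=> gu; rewrite /Qval /F hE subrr !dot0r; field; lra. Qed.

Lemma run_Q_ge k : F (x k.+1) <= run_Q k.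
Proof.
have [gy hz] := run_subgradients k; have [Ok1 _] := run_domain k.+1.
have gx0 := Omega_gt0 Ok1.
rewrite /run_Q /Qval /F hE; set u := x k.+1.
have cf : 0 <= (1 / g u) ^+ 2 * f u by rewrite mulr_ge0// sqr_ge0.
have := ler_wpM2l cf (gy u); have := hz u.
have -> : (1 / g u) ^+ 2 * f u * g u = f u / g u by field; rewrite gt_eqF.
have -> : 2 * (1 / g u) * f u = 2 * (f u / g u) by field; rewrite gt_eqF.
by lra.
Qed.

Lemma run_F_decr k : F (x k.+1) <= F (x k).
Proof.
apply: le_trans (run_Q_ge k) (le_trans _ (run_Q_le k)).
by rewrite lerDl mulr_ge0 ?sqr_ge0// ltW// divr_gt0.
Qed.

Lemma run_in_X k : X (x k).
Proof.
have [Ok Ck] := run_domain k; split; first exact/dom_objective.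
have [x0O x0C] := run_domain 0%N; rewrite -(proj1 run).
rewrite !objective_E// lee_fin.
by elim: (k) => // m IH; apply: le_trans (run_F_decr m) IH.
Qed.

Variable M : R.
Hypothesis M1 : 1 <= M.
Hypothesis X_bounds : forall u, X u -> local_bounds f g h1 h2 M u.
Hypothesis X_compact : compact X.

Let M0 : 0 < M. Proof. exact: lt_le_trans M1. Qed.

Let run_bounds k := X_bounds (run_in_X k).

(** Either the first trial is accepted, with step at least [alo], or the step just before the
    accepted one was rejected, hence exceeds the threshold of [line_search_accepts], and is shrunk
    once by [gamma]. *)
Lemma run_alpha : exists2 amin, 0 < amin & forall k, amin <= alpha k.
Proof.
have [a1 [a10 acc]] := line_search_accepts g C f_ge0 hE M1 sigma_gt0.
exists (Num.min alo (gamma * a1)); first by rewrite lt_min alo_gt0 mulr_gt0.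
move=> k; have [Ok Ck] := run_domain k.
have [_ /(_ k)[gy hz [a0 [j [xhat [/andP[a0l _] tr rej _ [_ ->]]]]]]] := run.
rewrite ge_min; case: j tr rej => [|j] tr rej; first by rewrite expr0 mulr1 a0l.
apply/orP; right; rewrite exprS mulrCA ler_pM2l// leNgt; apply/negP => a1_gt.
apply: (rej j (ltnSn j)); apply: acc (ltW a1_gt) (tr j (leqnSn j)) => //.
by rewrite mulr_gt0 ?exprn_gt0// (lt_le_trans alo_gt0).
Qed.

Lemma X_cvg (u : nat -> 'rV[R]_n) p : X p -> u @ \oo --> p ->
  [/\ (f \o u) @ \oo --> f p, (g \o u) @ \oo --> g p,
      (h2 \o u) @ \oo --> h2 p, (grad h1 \o u) @ \oo --> grad h1 p &
      (F \o u) @ \oo --> F p].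
Proof.
move=> Xp up; have pM := X_bounds Xp.
have MV0 : 0 < M^-1 by rewrite invr_gt0.
have fu : (f \o u) @ \oo --> f p.
  by apply: (cvg_lipschitz (L := M) MV0 _ up) => q /(bound_around pM)[].
have gu : (g \o u) @ \oo --> g p.
  by apply: (cvg_lipschitz (L := M) MV0 _ up) => q /(bound_around pM)[].
have h2u : (h2 \o u) @ \oo --> h2 p.
  by apply: (cvg_lipschitz (L := M) MV0 _ up) => q /(bound_around pM)[].
have gradu : (grad h1 \o u) @ \oo --> grad h1 p.
  by apply: (cvg_lipschitz (L := M) MV0 _ up) => q /(bound_around pM)[].
split=> //; have h1u : (h1 \o u) @ \oo --> h1 p.
  (* [n%:R * M] bounds the linear part; within [M^-1] the quadratic remainder is at most the
     distance itself, hence the [+ 1]. *)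
  apply: (cvg_lipschitz (L := n%:R * M + 1) MV0 _ up) => q qp.
  have [_ _ _ _ _ _ h1q] := bound_around pM qp.
  have -> : h1 q - h1 p = (h1 q - h1 p - dot (grad h1 p) (q - p))
    + dot (grad h1 p) (q - p) by rewrite subrK.
  apply: le_trans (ler_normD _ _) _; rewrite addrC mulrDl mul1r; apply: lerD.
    apply: le_trans (dot_le _ _) _; rewrite ler_wpM2r// ler_wpM2l//.
    exact: bound_grad pM.
  apply: le_trans h1q _; rewrite expr2 mulrA ler_piMl//.
  by rewrite -ler_pdivlMl// mulr1.
have [/dom_objective[/Omega_gt0 gp0 _] _] := Xp.
have -> : F p = f p * (g p)^-1 + (h1 p - h2 p) by rewrite /F hE.
have -> : F \o u = (f \o u) \* (fun k => (g (u k))^-1) + ((h1 \o u) - (h2 \o u)).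
  by apply/funext => k; rewrite /F /= hE.
apply: cvgD; last exact: cvgB.
by apply: cvgM => //; apply: cvgV => //; rewrite gt_eqF.
Qed.

Lemma X_closed : closed X.
Proof. exact: compact_closed (@norm_hausdorff _ _) X_compact. Qed.

(** The limit [l] is the value of [F] at a cluster point in the compact level set; monotonicity
    extends it to the whole sequence, and the gap between successive values controls the squared
    steps. *)
Lemma run_limit_value : exists l : R, [/\ (F \o x) @ \oo --> l,
  forall k, l <= F (x k), run_Q @ \oo --> l & run_D @ \oo --> 0].
Proof.
have [p [Xp xp0]] : exists p, X p /\ cluster (x @ \oo) p.
  have xX : (x @ \oo) X by exists 0%N => // k _; apply: run_in_X.
  by have [p [Xp xp]] := X_compact _ xX; exists p.
have [phi [phik xp]] := cluster_subsequence xp0.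
have [_ _ _ _ Fp] := X_cvg Xp xp.
have [Fl l_le] := nonincreasing_subseq_cvg run_F_decr phik Fp.
have F1l : (fun k => F (x k.+1)) @ \oo --> F p.
  by have := cvgn_geq_comp (phi := S) leqnSn Fl.
have Ql : run_Q @ \oo --> F p.
  apply: (squeeze_cvgr _ F1l Fl); apply: nearW => k; rewrite run_Q_ge /=.
  apply: le_trans (run_Q_le k); rewrite lerDl mulr_ge0 ?sqr_ge0//.
  by rewrite ltW// divr_gt0.
exists (F p); split => //.
have FFp : (fun k => F (x k) - F p) @ \oo --> 0.
  by rewrite -(subrr (F p)); apply: cvgB => //; exact: cvg_cst.
apply/cvgr0Pnorm_lt => e e0.
have c0 : 0 < sigma / 2 * e ^+ 2 by rewrite mulr_gt0 ?exprn_gt0// divr_gt0.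
move/cvgr0Pnorm_lt: FFp => /(_ _ c0); apply: filterS => k.
rewrite !ger0_norm ?norm2_ge0 ?subr_ge0// => Fk.
have := run_Q_le k; have := run_Q_ge k; have := l_le k.+1 => lk Qk1 Qk2.
have : sigma / 2 * run_D k ^+ 2 < sigma / 2 * e ^+ 2 by lra.
by rewrite ltr_pM2l ?divr_gt0// ltr_pXn2r ?nnegrE ?norm2_ge0// ltW.
Qed.

Lemma run_subgradient : exists K k0, 0 < K /\ forall k, (k0 <= k)%N ->
  exists xi, frechet_subdiff (Qvec f g h1 h2 C) (run_w k) xi /\
    norm2 xi <= K * run_D k.
Proof.
have [amin amin0 alpha_ge] := run_alpha.
have [K [r [K0 r0 bound]]] := trial_subgradient_bound g h1 h2 C f_ge0 M1 amin0.
have [_ [_ _ _ /cvgr0Pnorm_lt/(_ r r0)[k0 _ Dr]]] := run_limit_value.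
(* [K] may be 0, whereas [KL_finite_length] asks for a positive constant. *)
exists (K + 1), k0; split; first by rewrite ltr_wpDl.
move=> k k0k; have [gy hz] := run_subgradients k.
have [ak tr] := run_trial k; have [_ Ck] := run_domain k.
have dD : `|x k.+1 - x k| <= run_D k by exact: norm_le_norm2.
have [|xi [xi_sub xiK]] := bound _ _ _ _ _ (run_bounds k) (run_bounds k.+1) Ck
  gy hz (alpha_ge k) tr.
  apply: le_trans dD _; apply: ltW.
  by have := Dr k k0k; rewrite /= ger0_norm ?norm2_ge0.
exists xi; split => //; apply: le_trans xiK _.
by rewrite mulrDl mul1r ler_wpDr ?norm2_ge0// ler_wpM2l.
Qed.

Lemma run_w_bounded : exists B, forall k, `|run_w k| <= B.
Proof.
have [B B0 XB] := pinfty_ex_gt0 (compact_bounded X_compact).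
exists (Num.max B M) => k; have [gy hz] := run_subgradients k.
have [gx0 gxM] := local_bounds_center M1 (run_bounds k.+1).
apply: norm_quad_le; rewrite le_max; first by rewrite XB//; exact: run_in_X.
- by rewrite (bound_subdiff_g (run_bounds k) gy) orbT.
- by rewrite (bound_subdiff_h2 (run_bounds k) hz) orbT.
- by rewrite div1r gtr0_norm ?invr_gt0// gxM orbT.
Qed.

(** Vanishing steps make [x k] and [x k.+1] share their limits; continuity of [g] fixes the last
    coordinate, and the closed graphs of the convex subdifferentials keep [v] and [w] subgradients
    at [u]. *)
Lemma run_cluster p (phi : nat -> nat) : (forall k, (k <= phi k)%N) ->
  (run_w \o phi) @ \oo --> p -> exists u v w,
    [/\ p = quad u v w (1 / g u), X u, cvx_subdiff g u v, cvx_subdiff h2 u w &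
      [/\ (x \o phi) @ \oo --> u, (x \o S \o phi) @ \oo --> u,
          (y \o phi) @ \oo --> v & (z \o phi) @ \oo --> w]].
Proof.
move=> phik wp; have [u [v [w [c pE]]]] := quad_surj p; rewrite pE in wp *.
have [xSu yv zw cc] := quad_cvg wp.
have Xu : X u.
  apply: (closed_cvg _ X_closed _ _ xSu).
  by apply: nearW => k; apply: run_in_X.
have xu : (x \o phi) @ \oo --> u.
  have [_ [_ _ _ D0]] := run_limit_value.
  have Dphi := cvgn_geq_comp phik D0.
  apply/cvgrPdist_lt => e e0; have e2 : 0 < e / 2 by rewrite divr_gt0.
  move/cvgrPdist_lt: xSu => /(_ _ e2); move/cvgr0Pnorm_lt: Dphi => /(_ _ e2).
  apply: filterS2 => k; rewrite /= (ger0_norm (norm2_ge0 _)) => Dk xk.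
  rewrite -(subrK (x (phi k).+1) u) -addrA (le_lt_trans (ler_normD _ _))//.
  by have := norm_le_norm2 (x (phi k).+1 - x (phi k)); rewrite /run_D in Dk; lra.
have [_ gxu h2xu _ _] := X_cvg Xu xu.
have [_ gxSu _ _ _] := X_cvg Xu xSu.
have [/dom_objective[/Omega_gt0 gu0 _] _] := Xu.
have cE : c = 1 / g u.
  have cu : (fun k => 1 / g (x (phi k).+1)) @ \oo --> (1 / g u : R).
    under eq_fun do rewrite div1r; rewrite div1r.
    by apply: cvgV; rewrite ?gt_eqF.
  exact: (cvg_unique (@norm_hausdorff _ _) cc cu).
exists u, v, w; split => //; first by rewrite cE.
- by apply: (cvx_subdiff_closed xu yv gxu) => k; have [] := run_subgradients (phi k).
- by apply: (cvx_subdiff_closed xu zw h2xu) => k; have [] := run_subgradients (phi k).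
Qed.

(** The KL property is granted only where the limiting subdifferential is nonempty: the subgradients
    along the subsequence tend to 0 while Q tends to its value [l] at [p], so 0 belongs to it. *)
Lemma run_KL_along l K k0 p : (F \o x) @ \oo --> l -> run_Q @ \oo --> l ->
  run_D @ \oo --> 0 -> 0 < K ->
  (forall k, (k0 <= k)%N -> exists xi,
    frechet_subdiff (Qvec f g h1 h2 C) (run_w k) xi /\ norm2 xi <= K * run_D k) ->
  KL_function (Qvec f g h1 h2 C) -> cluster (run_w @ \oo) p ->
  exists2 U, nbhs p U & KL_along run_w (fun k => run_Q k - l) run_D K U.
Proof.
move=> Fl Ql D0 K0 subgrad [_ KL] /cluster_subsequence[phi [phik wp]].
have [u [v [w [pE Xu gv hw [xu xSu yv zw]]]]] := run_cluster phik wp.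
have [/dom_objective[gu Cu] _] := Xu; have gu0 := Omega_gt0 gu.
have Qp : Qvec f g h1 h2 C p = l%:E.
  rewrite pE Qvec_quad (Qfun_subgradient f h1 _ gv hw Cu) Qval_diag//.
  have [_ _ _ _ Fu] := X_cvg Xu xu.
  by rewrite (cvg_unique (@norm_hausdorff _ _) Fu (cvgn_geq_comp phik Fl)).
(* [lim_subdiff] asks for subgradients at every index, and they are only known from [k0] on. *)
have mk k : (k <= phi (k + k0))%N by apply: leq_trans (phik _); rewrite leq_addr.
have m_k0 k : (k0 <= phi (k + k0))%N by apply: leq_trans (phik _); rewrite leq_addl.
have [xi xiP] := choice (fun k => subgrad _ (m_k0 k)).
have p_sub : lim_subdiff (Qvec f g h1 h2 C) p 0.
  split; first by rewrite /dom /= Qp ltry.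
  exists (fun k => run_w (phi (k + k0)%N)), xi; split.
  - by have := cvgn_geq_comp (fun k => leq_addr k0 k) wp.
  - rewrite Qp; apply: cvg_EFin.
      by apply: nearW => k /=; rewrite Qvec_run.
    have -> : fine \o (Qvec f g h1 h2 C \o (fun k => run_w (phi (k + k0)%N)))
        = run_Q \o (fun k => phi (k + k0)%N).
      by apply/funext => k /=; rewrite Qvec_run.
    exact: cvgn_geq_comp mk Ql.
  - by move=> k; have [] := xiP k.
  apply/cvgr0Pnorm_lt => e e0; have eK : 0 < e / K by rewrite divr_gt0.
  move/cvgr0Pnorm_lt: (cvgn_geq_comp mk D0) => /(_ _ eK); apply: filterS => k.
  rewrite /= ger0_norm ?norm2_ge0// ltr_pdivlMr// mulrC.
  apply: le_lt_trans; apply: le_trans (norm_le_norm2 _) _.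
  by have [] := xiP k.
have /KL[eps [delta [psi [eps0 delta0 psi_des KLp]]]] :
    lim_subdiff (Qvec f g h1 h2 C) p !=set0 by exists 0.
have [e [e_eps gauge]] := desingularizing_gauge eps0 psi_des.
exists (ball2 p delta); first exact: nbhs_ball2.
exists e, psi, (derive1 psi), k0; split => // k k0k wk /andP[r0 re].
have [eta [eta_sub etaK]] := subgrad k k0k.
have := KLp (run_w k) wk; rewrite Qp Qvec_run lte_fin -subr_gt0 => /(_ r0).
have -> : ((run_Q k)%:E < l%:E + eps)%E.
  by apply: lt_le_trans (leeD2l _ e_eps); rewrite -EFinD lte_fin addrC -ltrBlDr.
move=> /(_ isT); rewrite -EFinB /= => KLk.
have [_ _ /(_ (run_Q k - l)) dpsi0 _] := gauge.
rewrite r0 re in dpsi0; have {}dpsi0 := dpsi0 isT.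
rewrite -lee_fin; apply: le_trans KLk _.
rewrite EFinM lee_wpmul2l ?lee_fin ?(ltW dpsi0)//.
(* A Frechet subgradient is a limiting one, by constant sequences. *)
apply: (@le_trans _ _ (norm2 (0 - eta))%:E).
  apply: ereal_inf_lbound; exists eta => //.
  split; first by case: eta_sub.
  exists (fun=> run_w k), (fun=> eta).
  by split => //; exact: cvg_cst.
by rewrite lee_fin norm2B subr0.
Qed.

Lemma run_converges : KL_function (Qvec f g h1 h2 C) -> cvgn x.
Proof.
move=> KL; have [l [Fl l_le Ql D0]] := run_limit_value.
have [K [k0 [K0 subgrad]]] := run_subgradient.
have [B wB] := run_w_bounded.
have s0 : 0 < sigma / 2 by rewrite divr_gt0.
have D_ge0 k : 0 <= run_D k by exact: norm2_ge0.
have KL_T := KL_along_compact (ltW K0) D_ge0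
  (@compact_norm_le R _ B) wB
  (fun p => run_KL_along Fl Ql D0 K0 subgrad KL (p := p)).
have [N [L DL]] : exists N L, forall m, \sum_(0 <= j < m) run_D (j + N)%N <= L.
  apply: (KL_finite_length K0 s0 D_ge0 _ _ _ KL_T).
  - by move=> k; rewrite subr_ge0 (le_trans (l_le k.+1))// run_Q_ge.
  (* The value [F (x k.+1)] lies between [run_Q k] and the decreased [run_Q k.+1], whence the index
     shift. *)
  - by move=> k; have := run_Q_le k.+1; have := run_Q_ge k; lra.
  by rewrite -(subrr l); apply: cvgB => //; exact: cvg_cst.
apply: (finite_length_cvg _ DL) => k; exact: norm_le_norm2.
Qed.

(** Only [x] converges, so limits [v] and [w] are taken along a subsequence of [run_w]. The proximal
    inequality passes to the limit as a quadratic minorant, which yields a Frechet subgradient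
    instead of a merely limiting one. *)
Lemma run_limit_critical u : x @ \oo --> u -> critical_point f g h1 h2 C u.
Proof.
move=> xu; have [B wB] := run_w_bounded.
have wA : (run_w @ \oo) [set w | `|w| <= B] by exists 0%N => // k _; exact: wB.
have [p [_ /cluster_subsequence[phi [phik wp]]]] :=
  @compact_norm_le R _ B _ _ wA.
have [u' [v [w [_ Xu gv hw [xu' xSu yv zw]]]]] := run_cluster phik wp.
have {xu}uE : u' = u.
  exact: (cvg_unique (@norm_hausdorff _ _) xu' (cvgn_geq_comp phik xu)).
rewrite {}uE in Xu gv hw xu' xSu.
have [/dom_objective[gu Cu] _] := Xu; have gu0 := Omega_gt0 gu.
split => //; exists (- gradient_step f g h1 u v w), v, w.
split => //; last first.
  by rewrite /gradient_step; apply/rowP => i; rewrite !mxE; ring.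
have [amin amin0 alpha_ge] := run_alpha.
(* A uniform bound on the proximal coefficients replaces the step sizes, which need not converge. *)
pose kappa := (2 * amin)^-1.
have kappa0 : 0 < kappa by rewrite invr_gt0 mulr_gt0.
have phiE t : C t -> ((1 / g u * f t)%:E + indic_ext R C t)%E = (1 / g u * f t)%:E.
  by move=> Ct; rewrite /indic_ext mem_set// adde0.
have [fu gu_cvg _ gradu _] := X_cvg Xu xu'.
have [fSu _ _ _ _] := X_cvg Xu xSu.
have c_cvg : (fun k => 1 / g (x (phi k))) @ \oo --> (1 / g u : R).
  under eq_fun do rewrite div1r; rewrite div1r.
  by apply: cvgV; rewrite ?gt_eqF.
have step_cvg : (fun k => gradient_step f g h1 (x (phi k)) (y (phi k)) (z (phi k)))
    @ \oo --> gradient_step f g h1 u v w.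
  rewrite /gradient_step; apply: cvgB; first exact: cvgB.
  apply: cvgZ => //; apply: cvgM => //.
  by under eq_fun do rewrite expr2; rewrite expr2; apply: cvgM.
have diff_cvg (t : 'rV[R]_n) : (fun k => t - x (phi k)) @ \oo --> t - u.
  by apply: cvgB => //; exact: cvg_cst.
have min_u t : C t -> 1 / g u * f u <= 1 / g u * f t
    + dot (gradient_step f g h1 u v w) (t - u) + kappa * dot (t - u) (t - u).
  move=> Ct.
  have lhs_cvg : (fun k => 1 / g (x (phi k)) * f (x (phi k).+1)
      + dot (gradient_step f g h1 (x (phi k)) (y (phi k)) (z (phi k)))
          (x (phi k).+1 - x (phi k))) @ \oo --> 1 / g u * f u.
    rewrite -[1 / g u * f u]addr0; apply: cvgD; first exact: cvgM.
    rewrite -(dot0r (gradient_step f g h1 u v w)) -(subrr u).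
    exact: (dot_cvg step_cvg (cvgB xSu xu')).
  have rhs_cvg : (fun k => 1 / g (x (phi k)) * f t
      + dot (gradient_step f g h1 (x (phi k)) (y (phi k)) (z (phi k)))
          (t - x (phi k)) + kappa * dot (t - x (phi k)) (t - x (phi k))) @ \oo -->
      1 / g u * f t + dot (gradient_step f g h1 u v w) (t - u)
      + kappa * dot (t - u) (t - u).
    apply: cvgD.
      apply: cvgD; first by apply: cvgM => //; exact: cvg_cst.
      exact: (dot_cvg step_cvg (diff_cvg t)).
    by apply: cvgM (dot_cvg (diff_cvg t) (diff_cvg t)); exact: cvg_cst.
  apply: (ler_cvg_to lhs_cvg rhs_cvg); apply: nearW => k.
  have [ak tr] := run_trial (phi k); have [Ok Ck] := run_domain (phi k).
  have [_ /(_ t Ct)] := trial_min ak (Omega_gt0 Ok) Ck tr.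
  have kap : (2 * alpha (phi k))^-1 <= kappa.
    by rewrite lef_pV2 ?posrE ?mulr_gt0// ler_pM2l.
  have := ler_wpM2r (dot_ge0 (t - x (phi k))) kap.
  have : 0 <= (2 * alpha (phi k))^-1 * norm2 (x (phi k).+1 - x (phi k)) ^+ 2.
    by rewrite mulr_ge0 ?sqr_ge0// invr_ge0 mulr_ge0// ltW.
  by rewrite !sqr_norm2; lra.
apply: (@frechet_subdiff_quadratic _ _ _ _ _ 1 (kappa * n%:R)).
- by rewrite phiE.
- by [].
- by rewrite mulr_ge0// ltW.
move=> t _; rewrite phiE// -EFinD.
have [Ct|nCt] := pselect (C t); last first.
  by rewrite /indic_ext memNset// addey// leey.
rewrite phiE// lee_fin dotNl; have := min_u t Ct.
have := ler_wpM2l (ltW kappa0) (le_trans (ler_norm _) (dot_le (t - u) (t - u))).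
by lra.
Qed.

End Run.

Theorem theorem13 (R : realType) (n : nat)
  (f g h h1 h2 : 'rV[R]_n -> R) (C : set 'rV[R]_n)
  (f_ge0 : forall x, 0 <= f x) (g_ge0 : forall x, 0 <= g x)
  (f_lsc : lower_semicontinuous (EFin \o f))
  (g_lsc : lower_semicontinuous (EFin \o g))
  (h_lsc : lower_semicontinuous (EFin \o h))
  (C_closed : closed C) (C_Omega : C `&` Omega g !=set0)
  (f_lip : locally_lipschitz (Omega g) f)
  (g_cvx : convex_function setT g)
  (hE : forall x, h x = h1 x - h2 x)
  (h1_diff : locally_lipschitz_differentiable (Omega g) h1)
  (h2_cvx : convex_function setT h2)
  (alo ahi sigma gamma : R)
  (alo_gt0 : 0 < alo) (alo_ahi : alo <= ahi) (sigma_gt0 : 0 < sigma)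
  (gamma_gt0 : 0 < gamma) (gamma_lt1 : gamma < 1)
  (x0 : 'rV[R]_n) (x0_dom : dom (objective f g h C) x0)
  (x y z : nat -> 'rV[R]_n) (alpha : nat -> R)
  (run : ampda_run f g h h1 h2 C alo ahi sigma gamma x0 x y z alpha)
  (level_compact : compact [set u | dom (objective f g h C) u /\
     (objective f g h C u <= objective f g h C x0)%E])
  (Q_proper : proper_fun (Qvec f g h1 h2 C))
  (Q_closed : lower_semicontinuous (Qvec f g h1 h2 C))
  (Q_KL : KL_function (Qvec f g h1 h2 C)) :
  exists xstar : 'rV[R]_n,
    x @ \oo --> xstar /\ critical_point f g h1 h2 C xstar.
Proof.
have [M [M1 XM]] := compact_local_bounds g_ge0 f_lip g_cvx h1_diff h2_cvx
  level_compact (fun u Xu => proj1 (proj1 (dom_objective _ _ _ _ _) (proj1 Xu))).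
exists (limn x).
have xl : x @ \oo --> limn x.
  exact: (run_converges f_ge0 g_ge0 hE alo_gt0 sigma_gt0 gamma_gt0 x0_dom run
    M1 XM level_compact Q_KL).
split => //.
exact: (run_limit_critical f_ge0 g_ge0 hE alo_gt0 sigma_gt0 gamma_gt0 x0_dom run
    M1 XM level_compact xl).
Qed.
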